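(* Let $\widehat{G}$ be a group with identity element $e$, let $G\leq\widehat{G}$ be a subgroup, and let $S=\bigoplus_{g\in G}S_g$ be a strongly $G$-graded unital ring with principal component $R:=S_e$ and Picard homomorphism $p:G\to\mathrm{Pic}(R)$, $g\mapsto[S_g]$. Let $\widehat{p}:\widehat{G}\to\mathrm{Pic}(R)$ be a group homomorphism extending $p$, and assume that the characteristic class $\kappa_S(\widehat{p})\in H^3_{\widehat{p}}(\widehat{G},G;\mathrm{U}(Z(R)))$ vanishes. Then the group $H^2_{\widehat{p}}(\widehat{G},G;\mathrm{U}(Z(R)))$ acts simply transitively (by twisting the multiplication maps by relative $2$-cocycles) on the equivalence classes of $\widehat{G}$-lifts of $S$ with Picard homomorphism $\widehat{p}$.
   Context: All rings are associative and unital, ring homomorphisms and module actions are unital; no commutativity is assumed. For a group $H$ with identity $e$, an $H$-grading on a ring $A$ is a family $(A_h)_{h\in H}$ of additive subgroups with $A=\bigoplus_{h}A_h$ and $A_hA_k\subseteq A_{hk}$; it is strong if $A_hA_k=A_{hk}$ for all $h,k\in H$. The principal component is $A_e$. An $R$-bimodule $M$ is invertible if there is an $R$-bimodule $N$ with $M\otimes_R N\cong R\cong N\otimes_R M$ as bimodules. $\mathrm{Pic}(R)$ is the group of isomorphism classes $[M]$ of invertible $R$-bimodules under $[M][N]=[M\otimes_R N]$. If $A$ is strongly $H$-graded with $A_e=R$, each $A_h$ is an invertible $R$-bimodule, multiplication induces $R$-bimodule isomorphisms $A_h\otimes_R A_k\to A_{hk}$, and the Picard homomorphism of $A$ is the group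 homomorphism $H\to\mathrm{Pic}(R)$, $h\mapsto[A_h]$. A $\widehat{G}$-lift of $S$ is a strongly $\widehat{G}$-graded unital ring $\widehat{S}=\bigoplus_{x\in\widehat{G}}\widehat{S}_x$ containing $S$ as a unital subring with $\widehat{S}_g=S_g$ for all $g\in G$. Two lifts are equivalent if there is a $\widehat{G}$-graded ring isomorphism between them restricting to $\mathrm{id}_S$ on $S$. $Z(R)$ is the center of $R$ and $\mathrm{U}(Z(R))$ its group of units. For an invertible $R$-bimodule $M$ there is a unique $\Delta_M\in\mathrm{Aut}(Z(R))$ with $mz=\Delta_M(z)m$ for all $m\in M$, $z\in Z(R)$; it depends only on $[M]$, and $[M]\mapsto\Delta_M$ is a group homomorphism $\mathrm{Pic}(R)\to\mathrm{Aut}(Z(R))$. Via $\widehat{p}$, $\widehat{G}$ acts on $\mathrm{U}(Z(R))$ by ${}^xu=\Delta_{\widehat{p}(x)}(u)$. Relative cohomology: let $C^n_{\widehat{p}}(\widehat{G},\mathrm{U}(Z(R)))$ be the group of normalized $n$-cochains (maps $\widehat{G}^n\to\mathrm{U}(Z(R))$ equal to $1$ whenever some argument is $e$) for this action, with the usual (multiplicatively written) group cohomology differential $d$. The relative complex $C^\bullet_{\widehat{p}}(\widehat{G},G;\mathrm{U}(Z(R)))$ is the kernel of the restriction of cochains from $\widehat{G}$ to $G$, so for $n\ge1$ it consists of the $c$ with $c|_{G^n}=1$. Its cocycle and cohomology groups are denoted $Z^n_{\widehat{p}}(\widehat{G},G;\mathrm{U}(Z(R)))$ and $H^n_{\widehat{p}}(\widehat{G},G;\mathrm{U}(Z(R)))$,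 $n\geq1$. Characteristic class: for each $x\in\widehat{G}$ choose an invertible $R$-bimodule $M_x$ representing $\widehat{p}(x)$, with $M_g=S_g$ for all $g\in G$ (so $M_e=R$). For all $x,y\in\widehat{G}$ choose $R$-bimodule isomorphisms $\mu_{x,y}:M_x\otimes_R M_y\to M_{xy}$ such that $\mu_{g,h}$ is the multiplication map $S_g\otimes_R S_h\to S_{gh}$ of $S$ for $g,h\in G$, and $\mu_{e,x},\mu_{x,e}$ are the canonical module actions for all $x\in\widehat{G}$. Such choices exist. For $x,y,z\in\widehat{G}$ there is a unique $\alpha(x,y,z)\in\mathrm{U}(Z(R))$ with $$\mu_{xy,z}\circ(\mu_{x,y}\otimes\mathrm{id}_{M_z})=\alpha(x,y,z)\,\mu_{x,yz}\circ(\mathrm{id}_{M_x}\otimes\mu_{y,z}).$$ The map $\alpha$ is a normalized relative $3$-cocycle whose class does not depend on the choices, and $\kappa_S(\widehat{p}):=[\alpha]\in H^3_{\widehat{p}}(\widehat{G},G;\mathrm{U}(Z(R)))$. The action: a lift $\widehat{S}$ with Picard homomorphism $\widehat{p}$ has homogeneous components $M_x:=\widehat{S}_x$ and multiplication maps $\mu_{x,y}:M_x\otimes_R M_y\to M_{xy}$. For $c\in Z^2_{\widehat{p}}(\widehat{G},G;\mathrm{U}(Z(R)))$, the twisted maps $\mu^c_{x,y}:=c(x,y)\mu_{x,y}$, $x,y\in\widehat{G}$, are again associative and extend the multiplication of $S$, so $\bigoplus_{x}M_x$ with multiplication given on homogeneous elements by $m_x m_y:=\mu^c_{x,y}(m_x\otimes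 m_y)$ is again a $\widehat{G}$-lift of $S$ with Picard homomorphism $\widehat{p}$; the class of $c$ sends the equivalence class of $\widehat{S}$ to that of this twisted lift. *)

(* Defs.v *)
From HB Require Import structures.
From mathcomp Require Import all_boot all_algebra.
From mathcomp Require Import boolp classical_sets.

Set Implicit Arguments.
Unset Strict Implicit.
Unset Printing Implicit Defensive.
Import GRing.Theory.
Local Open Scope ring_scope.
Local Open Scope quotient_scope.

Definition wholeGroup (H : groupType) : {pred H} := predT.

HB.instance Definition _ (H : groupType) :=
  isMulClosed.Build H (@wholeGroup H) (fun _ _ _ _ => isT).
HB.instance Definition _ (H : groupType) :=
  isMul1Closed.Build H (@wholeGroup H) isT.
HB.instance Definition _ (H : groupType) :=
  isInvClosed.Build H (@wholeGroup H) (fun _ _ => isT).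

(* A ring graded by the subgroup D of H.  The components are indexed by the
   whole of H so as to be total functions; those outside D are set to 0, so
   this is the same thing as a family indexed by D.  The fact that 1 lies in
   the component of degree 1 is a consequence (lemma [gcomp1]). *)
Record gradedRing (H : groupType) (D : groupClosed H) := GradedRing {
  gr_ring :> pzRingType;
  gcomp : H -> zmodClosed gr_ring;
  gcomp_out : forall h a, h \notin D -> a \in gcomp h -> a = 0;
  gcompM : forall h k a b,
    a \in gcomp h -> b \in gcomp k -> a * b \in gcomp (h * k)%g;
  gr_sum : forall a : gr_ring, exists (s : seq H) (f : H -> gr_ring),
    [/\ uniq s, forall h, f h \in gcomp h & a = \sum_(h <- s) f h];
  gr_direct : forall (s : seq H) (f : H -> gr_ring),
    uniq s -> (forall h, f h \in gcomp h) -> \sum_(h <- s) f h = 0 ->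
    forall h, h \in s -> f h = 0 }.

Arguments gcomp {H D} A h : rename.
Arguments gcompM {H D} A {h k a b} : rename.

(* A_h A_k is the set of finite sums of products, and A_h A_k <= A_(hk) is
   already part of the grading. *)
Definition strongly_graded (H : groupType) (D : groupClosed H)
    (A : gradedRing D) : Prop :=
  forall h k, h \in D -> k \in D -> forall a, a \in gcomp A (h * k)%g ->
  exists s : seq (A * A),
    (forall p, p \in s -> p.1 \in gcomp A h /\ p.2 \in gcomp A k) /\
    a = \sum_(p <- s) p.1 * p.2.

Lemma sum_incl (I : eqType) (V : zmodType) (f : I -> V) (s t : seq I) :
  uniq s -> uniq t -> {subset s <= t} -> (forall i, i \notin s -> f i = 0) ->
  \sum_(i <- t) f i = \sum_(i <- s) f i.
Proof.
move=> us ut st f0; rewrite (bigID (mem s)) /= [X in _ + X]big1 ?addr0//.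
rewrite -big_filter; apply: perm_big; apply: uniq_perm => //.
  by rewrite filter_uniq.
by move=> i; rewrite mem_filter; case: (boolP (i \in s)) => //= /st ->.
Qed.

Section Decomposition.
Variables (H : groupType) (D : groupClosed H) (A : gradedRing D).
Implicit Types (a b : A) (h k : H) (V : zmodType).

Definition supp a : seq H := projT1 (cid (gr_sum a)).

Definition proj a h : A :=
  if h \in supp a then projT1 (cid (projT2 (cid (gr_sum a)))) h else 0.

Lemma supp_uniq a : uniq (supp a).
Proof. by have [] := projT2 (cid (projT2 (cid (gr_sum a)))). Qed.

Lemma proj_in a h : proj a h \in gcomp A h.
Proof.
rewrite /proj; have [_ + _] := projT2 (cid (projT2 (cid (gr_sum a)))).
by move=> fA; case: ifP => // _; apply: rpred0.
Qed.

Lemma proj_out a h : h \notin supp a -> proj a h = 0.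
Proof. by rewrite /proj => /negbTE->. Qed.

Lemma proj_sum a : a = \sum_(h <- supp a) proj a h.
Proof.
have [_ _ ea] := projT2 (cid (projT2 (cid (gr_sum a)))).
rewrite {1}ea; rewrite big_seq [RHS]big_seq; apply: eq_bigr => h hs.
by rewrite /proj hs.
Qed.

Lemma proj_unique a (s : seq H) (f : H -> A) : uniq s ->
  (forall h, f h \in gcomp A h) -> (forall h, h \notin s -> f h = 0) ->
  a = \sum_(h <- s) f h -> forall h, proj a h = f h.
Proof.
move=> us fA f0 ea h.
pose t := undup (supp a ++ s); pose g k := proj a k - f k.
have ut : uniq t by rewrite undup_uniq.
have gA k : g k \in gcomp A k by rewrite rpredB// proj_in.
have g0 : \sum_(k <- t) g k = 0.
  rewrite sumrB (@sum_incl _ _ _ (supp a) t) ?supp_uniq//.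
  - rewrite (@sum_incl _ _ _ s t)//; first by rewrite -ea -proj_sum subrr.
    by move=> k ks; rewrite mem_undup mem_cat ks orbT.
  - by move=> k ks; rewrite mem_undup mem_cat ks.
  - by move=> k; apply: proj_out.
have [ht|] := boolP (h \in t).
  by apply/eqP; rewrite -subr_eq0; apply/eqP/(gr_direct ut gA g0 ht).
by rewrite mem_undup mem_cat negb_or => /andP[h1 h2]; rewrite proj_out ?f0.
Qed.

Lemma projD a b h : proj (a + b) h = proj a h + proj b h.
Proof.
pose t := undup (supp a ++ supp b).
apply: (@proj_unique _ t (fun k => proj a k + proj b k)).
- by rewrite undup_uniq.
- by move=> k; rewrite rpredD ?proj_in.
- move=> k; rewrite mem_undup mem_cat negb_or => /andP[k1 k2].
  by rewrite !proj_out ?addr0.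
rewrite big_split /= (@sum_incl _ _ _ (supp a) t) ?supp_uniq ?undup_uniq//.
- rewrite (@sum_incl _ _ _ (supp b) t) ?supp_uniq ?undup_uniq -?proj_sum//.
  + by move=> k ks; rewrite mem_undup mem_cat ks orbT.
  + by move=> k; apply: proj_out.
- by move=> k ks; rewrite mem_undup mem_cat ks.
- by move=> k; apply: proj_out.
Qed.

Lemma proj_homog a k h : a \in gcomp A k ->
  proj a h = if h == k then a else 0.
Proof.
move=> aA; move: h.
apply: (@proj_unique _ [:: k] (fun h => if h == k then a else 0)) => //.
- by move=> h; case: eqP => [->|] //; rewrite rpred0.
- by move=> h; rewrite inE => /negbTE ->.
- by rewrite big_seq1 eqxx.
Qed.

Lemma proj0 h : proj 0 h = 0.
Proof. by rewrite (@proj_homog 0 1%g) ?rpred0 ?if_same. Qed.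

Lemma proj_bigsum (I : Type) (r : seq I) (F : I -> A) h :
  proj (\sum_(i <- r) F i) h = \sum_(i <- r) proj (F i) h.
Proof.
elim: r => [|i r IH]; first by rewrite !big_nil proj0.
by rewrite !big_cons projD IH.
Qed.

Lemma homog_ind (P : A -> Prop) : P 0 -> (forall a b, P a -> P b -> P (a + b)) ->
  (forall h a, a \in gcomp A h -> P a) -> forall a, P a.
Proof.
move=> P0 PD Ph a; rewrite (proj_sum a).
by apply: big_ind => // h _; apply: (Ph h); apply: proj_in.
Qed.

Lemma gcomp1 : 1 \in gcomp A 1%g.
Proof.
pose e := proj 1 1%g.
suff ae a : a * e = a by rewrite -[X in X \in _](ae 1) mul1r proj_in.
elim/homog_ind: a => [|a b ha hb|k a ak]; first by rewrite mul0r.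
  by rewrite mulrDl ha hb.
have := proj_homog k ak; rewrite eqxx -{1}[a]mulr1 {1}[X in a * X]proj_sum.
rewrite mulr_sumr proj_bigsum => ea; rewrite -[RHS]ea.
under eq_bigr => h _.
  rewrite (proj_homog _ (gcompM A ak (proj_in 1 h))).
  rewrite eq_sym -{2}[k]mulg1 (inj_eq (@mulgI _ k)).
  have -> : (if h == 1%g then a * proj 1 h else 0) =
            (if h == 1%g then a * e else 0) by case: eqP => [->|].
  over.
have [h1|h1] := boolP (1%g \in supp 1).
  by rewrite (big_rem _ h1) /= eqxx big_seq big1 ?addr0// => h;
     rewrite mem_rem_uniq ?supp_uniq// !inE; case: eqP.
rewrite /e proj_out// mulr0 big1// => h _; by rewrite if_same.
Qed.

(* Extension by additivity of a family of additive maps defined on the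
   homogeneous components. *)
Definition gsum V (F : H -> A -> V) a : V :=
  \sum_(h <- supp a) F h (proj a h).

Lemma gsumD V (F : H -> A -> V) a b :
  (forall h, {morph F h : x y / x + y}) ->
  gsum F (a + b) = gsum F a + gsum F b.
Proof.
move=> FD; have F0 h : F h 0 = 0.
  by apply: (addIr (F h 0)); rewrite -FD !add0r.
pose t := undup (supp a ++ supp b ++ supp (a + b)).
have E c : {subset supp c <= t} -> gsum F c = \sum_(h <- t) F h (proj c h).
  move=> ct; rewrite (@sum_incl _ _ _ (supp c) t) ?supp_uniq ?undup_uniq//.
  by move=> h hc; rewrite proj_out.
rewrite !E ?/t -?big_split /=; last 3 first.
- by move=> k ks; rewrite mem_undup !mem_cat ks ?orbT.
- by move=> k ks; rewrite mem_undup !mem_cat ks ?orbT.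
- by move=> k ks; rewrite mem_undup !mem_cat ks ?orbT.
by apply: eq_bigr => h _; rewrite projD FD.
Qed.

Lemma gsum_homog V (F : H -> A -> V) a h : (forall h, F h 0 = 0) ->
  a \in gcomp A h -> gsum F a = F h a.
Proof.
move=> F0 aA; rewrite /gsum -(@sum_incl _ _ _ _ (undup (h :: supp a))) //.
- rewrite (@sum_incl _ _ _ [:: h]) ?undup_uniq ?big_seq1//.
  + by rewrite (proj_homog _ aA) eqxx.
  + by move=> k; rewrite inE mem_undup inE => ->.
  + by move=> k; rewrite inE (proj_homog _ aA) => /negbTE->.
- exact: supp_uniq.
- exact: undup_uniq.
- by move=> k ks; rewrite mem_undup inE ks orbT.
- by move=> k ks; rewrite proj_out.
Qed.

Lemma gsum_ext V (F F' : H -> A -> V) a :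
  (forall h x, x \in gcomp A h -> F h x = F' h x) -> gsum F a = gsum F' a.
Proof. by move=> e; apply: eq_bigr => h _; apply/e/proj_in. Qed.

Lemma gsumDf V (F F' : H -> A -> V) a :
  gsum (fun h x => F h x + F' h x) a = gsum F a + gsum F' a.
Proof. by rewrite /gsum big_split. Qed.

End Decomposition.

Section Components.
Variables (H : groupType) (D : groupClosed H) (A : gradedRing D).

Definition gcomp_pred (h : H) : {pred A} := fun a => a \in gcomp A h.

Fact gcomp_zmod_closed h : zmod_closed (gcomp_pred h).
Proof. by split; [apply: rpred0 | move=> a b; apply: rpredB]. Qed.

Definition gcar h := {a : A | gcomp_pred h a}.
HB.instance Definition _ h := SubChoice.on (gcar h).
HB.instance Definition _ h :=
  GRing.SubChoice_isSubZmodule.Build A (gcomp_pred h) (gcar h)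
    (gcomp_zmod_closed h).

Definition gmul h k (a : gcar h) (b : gcar k) : gcar (h * k)%g :=
  Sub (val a * val b) (gcompM A (valP a) (valP b)).

Fact principal_subring : subring_closed (gcomp_pred 1%g).
Proof.
split; [exact: gcomp1 | exact: rpredB|].
by move=> a b aA bA; have := gcompM A aA bA; rewrite mulg1.
Qed.

Definition principal := gcar 1%g.
HB.instance Definition _ := SubChoice.on principal.
HB.instance Definition _ := GRing.SubChoice_isSubPzRing.Build
  A (gcomp_pred 1%g) principal principal_subring.
End Components.

Arguments gmul {H D A h k} a b.

(* Bimodules: [a *: m] is the left action, [m <*: r] the right one. *)
Record bimodType (R : pzRingType) := Bimod {
  bimod_left :> lmodType R;
  ract : bimod_left -> R -> bimod_left;
  ractDl : forall r, {morph ract ^~ r : m n / m + n};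
  ractDr : forall m, {morph ract m : r s / r + s};
  ract1 : forall m, ract m 1 = m;
  ractA : forall m r s, ract m (r * s) = ract (ract m r) s;
  ractZ : forall r m s, ract (r *: m) s = r *: ract m s }.

Notation "m <*: r" := (ract m r) (at level 40, left associativity).

Section BimodTheory.
Variables (R : pzRingType) (M : bimodType R).
Lemma ract0l r : (0 : M) <*: r = 0.
Proof. by apply: (addIr (0 <*: r)); rewrite -ractDl !add0r. Qed.
Lemma ract0r (m : M) : m <*: 0 = 0.
Proof. by apply: (addIr (m <*: 0)); rewrite -ractDr !add0r. Qed.
Lemma ract_suml I (r : seq I) (F : I -> M) s :
  (\sum_(i <- r) F i) <*: s = \sum_(i <- r) F i <*: s.
Proof. exact: (big_morph (fun m => m <*: s) (ractDl s) (ract0l s)). Qed.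
Lemma ract_sumr I (r : seq I) (F : I -> R) (m : M) :
  m <*: (\sum_(i <- r) F i) = \sum_(i <- r) m <*: F i.
Proof. exact: (big_morph (ract m) (ractDr m) (ract0r m)). Qed.
End BimodTheory.

Definition bimod_hom (R : pzRingType) (M N : bimodType R) (f : M -> N) : Prop :=
  [/\ {morph f : m n / m + n}, forall r m, f (r *: m) = r *: f m
    & forall m r, f (m <*: r) = f m <*: r].

Definition bimod_isom (R : pzRingType) (M N : bimodType R) (f : M -> N) : Prop :=
  bimod_hom f /\ bijective f.

Definition bimod_iso (R : pzRingType) (M N : bimodType R) : Prop :=
  exists f : M -> N, bimod_isom f.

Section Regular.
Variable R : pzRingType.
Fact regular_ractDl (r : R) : {morph ( *%R^~ r : R^o -> R^o) : m n / m + n}.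
Proof. by move=> m n; rewrite mulrDl. Qed.
Fact regular_ractZ (r : R) (m : R^o) (s : R) :
  (r *: m : R) * s = r *: (m * s : R^o).
Proof. by rewrite /GRing.scale/= mulrA. Qed.
Definition regularBimod : bimodType R :=
  @Bimod R R^o (fun m r => (m : R) * r) regular_ractDl
    (@mulrDr R) (@mulr1 R) (@mulrA R) regular_ractZ.
End Regular.
(* Tensor product of bimodules.  M (x)_R N is the set of finite formal sums of
   pairs (m, n), i.e. sequences of pairs, modulo the congruence generated by
   commutativity, biadditivity and R-balancedness.  No formal negatives are
   needed: (- m, n) is an opposite of (m, n), because (0, n) is identified
   with the empty sum. *)
Section Tensor.
Variables (R : pzRingType) (M N : bimodType R).

Inductive tens_rel : seq (M * N) -> seq (M * N) -> Prop :=
| TensRefl s : tens_rel s s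
| TensSym s t : tens_rel s t -> tens_rel t s
| TensTrans s t u : tens_rel s t -> tens_rel t u -> tens_rel s u
| TensCat s s' t t' :
    tens_rel s s' -> tens_rel t t' -> tens_rel (s ++ t) (s' ++ t')
| TensComm s t : tens_rel (s ++ t) (t ++ s)
| TensZero n : tens_rel [:: (0, n)] [::]
| TensAddl m m' n : tens_rel [:: (m + m', n)] [:: (m, n); (m', n)]
| TensAddr m n n' : tens_rel [:: (m, n + n')] [:: (m, n); (m, n')]
| TensBal m r n : tens_rel [:: (m <*: r, n)] [:: (m, r *: n)].

Definition tens_eqb : rel (seq (M * N)) := fun s t => `[< tens_rel s t >].

Fact tens_eqb_refl : reflexive tens_eqb.
Proof. by move=> s; apply/asboolP; constructor. Qed.
Fact tens_eqb_sym : symmetric tens_eqb.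
Proof.
by move=> s t; apply/idP/idP => /asboolP h; apply/asboolP; apply: TensSym.
Qed.
Fact tens_eqb_trans : transitive tens_eqb.
Proof.
by move=> s t u /asboolP h1 /asboolP h2; apply/asboolP; apply: TensTrans h1 h2.
Qed.
Canonical tens_equiv :=
  EquivRel tens_eqb tens_eqb_refl tens_eqb_sym tens_eqb_trans.

Definition tens_car := {eq_quot tens_equiv}.
HB.instance Definition _ := Choice.on tens_car.
HB.instance Definition _ := EqQuotient.on tens_car.

Definition tens_pi (s : seq (M * N)) : tens_car := \pi_tens_car s.

Lemma tens_piP s t : tens_pi s = tens_pi t <-> tens_rel s t.
Proof.
by split=> [/eqquotP /asboolP|h] //; apply/eqquotP/asboolP.
Qed.

Lemma tens_reprK (t : tens_car) : tens_pi (repr t) = t.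
Proof. exact: reprK. Qed.

Lemma tens_repr_pi s : tens_rel (repr (tens_pi s)) s.
Proof. by apply/tens_piP; rewrite tens_reprK. Qed.

Definition tens_zero := tens_pi [::].
Definition tens_add (t u : tens_car) := tens_pi (repr t ++ repr u).
Definition tens_opp (t : tens_car) := tens_pi [seq (- p.1, p.2) | p <- repr t].

Lemma tens_pi_cat s t : tens_add (tens_pi s) (tens_pi t) = tens_pi (s ++ t).
Proof. by apply/tens_piP; apply: TensCat; apply: tens_repr_pi. Qed.

Fact tens_addA : associative tens_add.
Proof.
move=> a b c; rewrite -(tens_reprK a) -(tens_reprK b) -(tens_reprK c).
by rewrite !tens_pi_cat catA.
Qed.
Fact tens_addC : commutative tens_add.
Proof.
move=> a b; rewrite -(tens_reprK a) -(tens_reprK b) !tens_pi_cat.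
by apply/tens_piP; apply: TensComm.
Qed.
Fact tens_add0 : left_id tens_zero tens_add.
Proof. by move=> a; rewrite -(tens_reprK a) tens_pi_cat. Qed.
Fact tens_addN : left_inverse tens_zero tens_opp tens_add.
Proof.
move=> a; rewrite -{2}(tens_reprK a) /tens_opp tens_pi_cat.
apply/tens_piP; elim: (repr a) => [|[m n] s IH] /=; first exact: TensRefl.
set ns := [seq _ | _ <- s] in IH *.
have h1 : tens_rel (ns ++ (m, n) :: s) ((m, n) :: (ns ++ s)).
  rewrite -[_ :: s]cat1s catA -[_ :: (ns ++ s)]/(([:: (m, n)] ++ ns) ++ s).
  by apply: TensCat (TensRefl _); apply: TensComm.
apply: TensTrans (TensCat (TensRefl [:: (- m, n)]) h1) _.
rewrite -[_ ++ _]/([:: (- m, n); (m, n)] ++ (ns ++ s)).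
apply: (TensTrans (t := [::] ++ [::])); last exact: TensRefl.
apply: TensCat IH; apply: TensTrans (TensSym (TensAddl _ _ _)) _.
by rewrite addNr; apply: TensZero.
Qed.
HB.instance Definition _ :=
  GRing.isZmodule.Build tens_car tens_addA tens_addC tens_add0 tens_addN.

Definition pure (m : M) (n : N) : tens_car := tens_pi [:: (m, n)].

Lemma tens_piE s : tens_pi s = \sum_(p <- s) pure p.1 p.2.
Proof.
elim: s => [|[m n] s IH]; first by rewrite big_nil.
by rewrite big_cons -IH -[RHS]/(tens_add _ _) tens_pi_cat.
Qed.

Lemma tens_sum (t : tens_car) : t = \sum_(p <- repr t) pure p.1 p.2.
Proof. by rewrite -tens_piE tens_reprK. Qed.

Lemma pureDl n : {morph pure ^~ n : m m' / m + m'}.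
Proof.
move=> m m'; rewrite /= -[RHS]/(tens_add _ _) tens_pi_cat.
by apply/tens_piP; apply: TensAddl.
Qed.
Lemma pureDr m : {morph pure m : n n' / n + n'}.
Proof.
move=> n n'; rewrite -[RHS]/(tens_add _ _) tens_pi_cat.
by apply/tens_piP; apply: TensAddr.
Qed.
Lemma pure_bal m r n : pure (m <*: r) n = pure m (r *: n).
Proof. by apply/tens_piP; apply: TensBal. Qed.

Lemma tens_ind (P : tens_car -> Prop) : P 0 ->
  (forall t u, P t -> P u -> P (t + u)) -> (forall m n, P (pure m n)) ->
  forall t, P t.
Proof.
by move=> P0 PD Pp t; rewrite (tens_sum t); apply: big_ind.
Qed.

Definition balanced (V : zmodType) (f : M -> N -> V) : Prop :=
  [/\ forall n, {morph f ^~ n : m m' / m + m'},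
      forall m, {morph f m : n n' / n + n'}
    & forall m r n, f (m <*: r) n = f m (r *: n)].

Definition tens_lift (V : zmodType) (f : M -> N -> V) (t : tens_car) : V :=
  \sum_(p <- repr t) f p.1 p.2.

Section Lift.
Variables (V : zmodType) (f : M -> N -> V).
Hypothesis fb : balanced f.

Lemma tens_lift_rel s t :
  tens_rel s t -> \sum_(p <- s) f p.1 p.2 = \sum_(p <- t) f p.1 p.2.
Proof.
have [fl fr fbal] := fb.
elim=> //=.
- by move=> s1 t1 u1 _ -> _ ->.
- by move=> s1 s1' t1 t1' _ e1 _ e2; rewrite !big_cat /= e1 e2.
- by move=> s1 t1; rewrite !big_cat /= addrC.
- move=> n; rewrite big_seq1 big_nil /=.
  by apply: (addIr (f 0 n)); rewrite -fl !add0r.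
- by move=> m m' n; rewrite big_seq1 !big_cons big_nil addr0 /= fl.
- by move=> m m' n; rewrite big_seq1 !big_cons big_nil addr0 /= fr.
- by move=> m r n; rewrite !big_seq1 /= fbal.
Qed.

Lemma tens_lift_pi s : tens_lift f (tens_pi s) = \sum_(p <- s) f p.1 p.2.
Proof. by apply: tens_lift_rel; apply: tens_repr_pi. Qed.

Lemma tens_liftE m n : tens_lift f (pure m n) = f m n.
Proof. by rewrite tens_lift_pi big_seq1. Qed.

Lemma tens_liftD : {morph tens_lift f : t u / t + u}.
Proof.
move=> t u; rewrite -(tens_reprK t) -(tens_reprK u).
by rewrite -[_ + _]/(tens_add _ _) tens_pi_cat !tens_lift_pi big_cat.
Qed.

Lemma tens_lift0 : tens_lift f 0 = 0.
Proof. by apply: (addIr (tens_lift f 0)); rewrite -tens_liftD !add0r. Qed.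
End Lift.

Fact tens_scale_bal (r : R) : balanced (fun m n => pure (r *: m) n).
Proof.
split=> [n m m'|m n n'|m s n] /=.
- by rewrite scalerDr pureDl.
- by rewrite pureDr.
- by rewrite -ractZ pure_bal.
Qed.
Fact tens_ract_bal (r : R) : balanced (fun m n => pure m (n <*: r)).
Proof.
split=> [n m m'|m n n'|m s n] /=.
- by rewrite pureDl.
- by rewrite ractDl pureDr.
- by rewrite pure_bal ractZ.
Qed.

Definition tens_scale (r : R) : tens_car -> tens_car :=
  tens_lift (fun m n => pure (r *: m) n).
Definition tens_ract (t : tens_car) (r : R) : tens_car :=
  tens_lift (fun m n => pure m (n <*: r)) t.

Fact tens_scaleA r s t : tens_scale r (tens_scale s t) = tens_scale (r * s) t.
Proof.
rewrite /tens_scale; elim/tens_ind: t => [|t u IH1 IH2|m n].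
- by rewrite !(tens_lift0 (tens_scale_bal _)).
- by rewrite !(tens_liftD (tens_scale_bal _)) IH1 IH2.
- by rewrite !(tens_liftE (tens_scale_bal _)) scalerA.
Qed.
Fact tens_scale1 : left_id 1 tens_scale.
Proof.
move=> t; rewrite /tens_scale; elim/tens_ind: t => [|t u IH1 IH2|m n].
- by rewrite !(tens_lift0 (tens_scale_bal _)).
- by rewrite !(tens_liftD (tens_scale_bal _)) IH1 IH2.
- by rewrite !(tens_liftE (tens_scale_bal _)) scale1r.
Qed.
Fact tens_scaleDr : right_distributive tens_scale +%R.
Proof. by move=> r t u; rewrite /tens_scale (tens_liftD (tens_scale_bal r)). Qed.
Fact tens_scaleDl t : {morph tens_scale^~ t : r s / r + s}.
Proof.
move=> r s; rewrite /tens_scale; elim/tens_ind: t => [|t u IH1 IH2|m n].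
- by rewrite !(tens_lift0 (tens_scale_bal _)) addr0.
- by rewrite !(tens_liftD (tens_scale_bal _)) IH1 IH2 addrACA.
- by rewrite !(tens_liftE (tens_scale_bal _)) scalerDl pureDl.
Qed.
HB.instance Definition _ := GRing.Zmodule_isLmodule.Build R tens_car
  tens_scaleA tens_scale1 tens_scaleDr tens_scaleDl.

Fact tens_ractDl r : {morph tens_ract ^~ r : t u / t + u}.
Proof. by move=> t u; rewrite /tens_ract (tens_liftD (tens_ract_bal r)). Qed.
Fact tens_ractDr t : {morph tens_ract t : r s / r + s}.
Proof.
move=> r s; rewrite /tens_ract; elim/tens_ind: t => [|t u IH1 IH2|m n].
- by rewrite !(tens_lift0 (tens_ract_bal _)) addr0.
- by rewrite !(tens_liftD (tens_ract_bal _)) IH1 IH2 addrACA.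
- by rewrite !(tens_liftE (tens_ract_bal _)) ractDr pureDr.
Qed.
Fact tens_ract1 t : tens_ract t 1 = t.
Proof.
rewrite /tens_ract; elim/tens_ind: t => [|t u IH1 IH2|m n].
- by rewrite !(tens_lift0 (tens_ract_bal _)).
- by rewrite !(tens_liftD (tens_ract_bal _)) IH1 IH2.
- by rewrite !(tens_liftE (tens_ract_bal _)) ract1.
Qed.
Fact tens_ractA t r s : tens_ract t (r * s) = tens_ract (tens_ract t r) s.
Proof.
rewrite /tens_ract; elim/tens_ind: t => [|t u IH1 IH2|m n].
- by rewrite !(tens_lift0 (tens_ract_bal _)).
- by rewrite !(tens_liftD (tens_ract_bal _)) IH1 IH2.
- by rewrite !(tens_liftE (tens_ract_bal _)) ractA.
Qed.
Fact tens_ractZ r (t : tens_car) s : tens_ract (r *: t) s = r *: tens_ract t s.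
Proof.
rewrite /tens_ract -![_ *: _]/(tens_scale _ _) /tens_scale.
elim/tens_ind: t => [|t u IH1 IH2|m n].
- by rewrite !(tens_lift0 (tens_ract_bal _), tens_lift0 (tens_scale_bal _)).
- by rewrite !(tens_liftD (tens_ract_bal _), tens_liftD (tens_scale_bal _)) IH1 IH2.
- by rewrite !(tens_liftE (tens_ract_bal _), tens_liftE (tens_scale_bal _)).
Qed.

Definition tens : bimodType R :=
  @Bimod R tens_car tens_ract tens_ractDl tens_ractDr tens_ract1 tens_ractA
    tens_ractZ.

Definition tpure (m : M) (n : N) : tens := pure m n.

Lemma tpureDl n : {morph tpure ^~ n : m m' / m + m'}.
Proof. exact: pureDl. Qed.
Lemma tpureDr m : {morph tpure m : n n' / n + n'}.
Proof. exact: pureDr. Qed.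
Lemma tpure_bal m r n : tpure (m <*: r) n = tpure m (r *: n).
Proof. exact: pure_bal. Qed.
Lemma tpureZ r m n : r *: tpure m n = tpure (r *: m) n.
Proof. by rewrite -[LHS]/(tens_lift _ _) (tens_liftE (tens_scale_bal _)). Qed.
Lemma tpure_ract m n r : tpure m n <*: r = tpure m (n <*: r).
Proof. by rewrite -[LHS]/(tens_lift _ _) (tens_liftE (tens_ract_bal _)). Qed.
End Tensor.

Arguments tpure {R M N} m n.
Notation "m \ox n" := (tpure m n) (at level 40, left associativity).
Section HomTheory.
Variable R : pzRingType.
Implicit Types M N P Q : bimodType R.

Lemma bimod_hom0 M N (f : M -> N) : bimod_hom f -> f 0 = 0.
Proof. by case=> fD _ _; apply: (addIr (f 0)); rewrite -fD !add0r. Qed.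

Lemma bimod_hom_sum M N (f : M -> N) I (s : seq I) (F : I -> M) :
  bimod_hom f -> f (\sum_(i <- s) F i) = \sum_(i <- s) f (F i).
Proof.
by move=> hf; apply: (big_morph f) => //; [case: hf | apply: bimod_hom0].
Qed.

Lemma bimod_hom_comp M N P (f : M -> N) (g : N -> P) :
  bimod_hom f -> bimod_hom g -> bimod_hom (g \o f).
Proof.
move=> [fD fZ fr] [gD gZ gr].
by split=> [m n|r m|m r] /=; rewrite ?fD ?gD ?fZ ?gZ ?fr ?gr.
Qed.

Lemma bimod_hom_id M : bimod_hom (@id M).
Proof. by []. Qed.

Lemma bimod_hom_inv M N (f : M -> N) (g : N -> M) :
  bimod_hom f -> cancel f g -> cancel g f -> bimod_hom g.
Proof.
move=> [fD fZ fr] fK gK.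
by split=> [m n|r m|m r]; apply: (can_inj fK); rewrite ?(fD, fZ, fr) !gK.
Qed.

Lemma bimod_isom_inv M N (f : M -> N) : bimod_isom f ->
  exists g : N -> M, [/\ bimod_isom g, cancel f g & cancel g f].
Proof.
case=> hf [g fK gK]; exists g; split=> //; split; last by exists f.
exact: bimod_hom_inv hf fK gK.
Qed.

Lemma bimod_isom_comp M N P (f : M -> N) (g : N -> P) :
  bimod_isom f -> bimod_isom g -> bimod_isom (g \o f).
Proof.
move=> [hf bf] [hg bg]; split; [exact: bimod_hom_comp | exact: bij_comp].
Qed.

Lemma bimod_iso_refl M : bimod_iso M M.
Proof. by exists id; split=> //; exists id. Qed.

Lemma bimod_iso_sym M N : bimod_iso M N -> bimod_iso N M.
Proof. by case=> f /bimod_isom_inv [g [hg _ _]]; exists g. Qed.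

Lemma bimod_iso_trans M N P : bimod_iso M N -> bimod_iso N P -> bimod_iso M P.
Proof. by case=> f hf [g hg]; exists (g \o f); apply: bimod_isom_comp. Qed.

Lemma tens_ext M N (V : zmodType) (f g : tens M N -> V) :
  {morph f : t u / t + u} -> {morph g : t u / t + u} ->
  (forall m n, f (m \ox n) = g (m \ox n)) -> f =1 g.
Proof.
move=> fD gD fg; elim/tens_ind => [|t u IH1 IH2|m n]; last exact: fg.
  have f0 : f 0 = 0 by apply: (addIr (f 0)); rewrite -fD !add0r.
  have g0 : g 0 = 0 by apply: (addIr (g 0)); rewrite -gD !add0r.
  by rewrite f0 g0.
by rewrite fD gD IH1 IH2.
Qed.

Lemma tens_lift_hom M N P (f : M -> N -> P) : balanced f ->
  (forall r m n, f (r *: m) n = r *: f m n) ->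
  (forall m n r, f m (n <*: r) = f m n <*: r) ->
  bimod_hom (tens_lift f : tens M N -> P).
Proof.
move=> fb fZ fr; have fD := tens_liftD fb; split=> // [r t|t r].
  move: t; apply: (tens_ext (f := fun t => tens_lift f (r *: t))
                            (g := fun t => r *: tens_lift f t)).
  - by move=> t u; rewrite scalerDr fD.
  - by move=> t u; rewrite fD scalerDr.
  - by move=> m n; rewrite tpureZ !(tens_liftE fb) fZ.
move: t; apply: (tens_ext (f := fun t => tens_lift f (t <*: r))
                          (g := fun t => tens_lift f t <*: r)).
- by move=> t u; rewrite ractDl fD.
- by move=> t u; rewrite fD ractDl.
- by move=> m n; rewrite tpure_ract !(tens_liftE fb) fr.
Qed.

Section Map.
Variables (M M' N N' : bimodType R) (f : M -> M') (g : N -> N').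
Definition tens_map : tens M N -> tens M' N' :=
  tens_lift (fun m n => f m \ox g n).
Hypotheses (hf : bimod_hom f) (hg : bimod_hom g).
Fact tens_map_bal : balanced (fun m n => f m \ox g n).
Proof.
case: hf hg => [fD fZ fr] [gD gZ gr]; split=> [n m m'|m n n'|m r n].
- by rewrite fD tpureDl.
- by rewrite gD tpureDr.
- by rewrite fr gZ tpure_bal.
Qed.
Lemma tens_mapE m n : tens_map (m \ox n) = f m \ox g n.
Proof. by rewrite /tens_map (tens_liftE tens_map_bal). Qed.
Lemma tens_map_hom : bimod_hom tens_map.
Proof.
case: hf hg => [fD fZ fr] [gD gZ gr].
apply: tens_lift_hom; first exact: tens_map_bal.
  by move=> r m n; rewrite fZ tpureZ.
by move=> m n r; rewrite gr tpure_ract.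
Qed.
End Map.

Lemma tens_map_can M M' N N' (f : M -> M') (g : N -> N') f' g' :
  bimod_hom f -> bimod_hom g -> bimod_hom f' -> bimod_hom g' ->
  cancel f f' -> cancel g g' -> cancel (tens_map f g) (tens_map f' g').
Proof.
move=> hf hg hf' hg' fK gK; have h := tens_map_hom hf hg.
have h' := tens_map_hom hf' hg'.
apply: (tens_ext (f := tens_map f' g' \o tens_map f g) (g := id)) => //.
  by case: (bimod_hom_comp h h').
by move=> m n; rewrite /= !tens_mapE// fK gK.
Qed.

Lemma tens_map_isom M M' N N' (f : M -> M') (g : N -> N') :
  bimod_isom f -> bimod_isom g -> bimod_isom (tens_map f g).
Proof.
move=> If Ig; have [f' [[hf' _] fK f'K]] := bimod_isom_inv If.
have [g' [[hg' _] gK g'K]] := bimod_isom_inv Ig.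
case: If Ig => [hf _] [hg _]; split; first exact: tens_map_hom.
by exists (tens_map f' g'); apply: tens_map_can.
Qed.

Lemma tens_iso M M' N N' :
  bimod_iso M M' -> bimod_iso N N' -> bimod_iso (tens M N) (tens M' N').
Proof. by case=> f hf [g hg]; exists (tens_map f g); apply: tens_map_isom. Qed.

Section Assoc.
Variables (M N P : bimodType R).

Fact tens_assoc_bal1 (p : P) :
  balanced (fun (m : M) (n : N) => m \ox (n \ox p)).
Proof.
split=> [n m m'|m n n'|m r n].
- by rewrite tpureDl.
- by rewrite tpureDl tpureDr.
- by rewrite tpure_bal tpureZ.
Qed.
Definition tens_assoc1 (t : tens M N) (p : P) : tens M (tens N P) :=
  tens_lift (fun (m : M) (n : N) => m \ox (n \ox p)) t.
Lemma tens_assoc1E m n p : tens_assoc1 (m \ox n) p = m \ox (n \ox p).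
Proof. exact: (tens_liftE (tens_assoc_bal1 _)). Qed.
Lemma tens_assoc1D p : {morph tens_assoc1 ^~ p : t u / t + u}.
Proof. exact: (tens_liftD (tens_assoc_bal1 p)). Qed.
Fact tens_assoc_bal : balanced tens_assoc1.
Proof.
split=> [p|t p p'|t r p]; first exact: tens_assoc1D.
- move: t; apply: (tens_ext (f := tens_assoc1 ^~ (p + p'))
    (g := fun t => tens_assoc1 t p + tens_assoc1 t p')).
  + exact: tens_assoc1D.
  + by move=> t u; rewrite !tens_assoc1D addrACA.
  by move=> m n; rewrite !tens_assoc1E !tpureDr.
- move: t; apply: (tens_ext (f := fun t => tens_assoc1 (t <*: r) p)
    (g := tens_assoc1 ^~ (r *: p))).
  + by move=> t u; rewrite ractDl tens_assoc1D.
  + exact: tens_assoc1D.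
  by move=> m n; rewrite tpure_ract !tens_assoc1E tpure_bal.
Qed.
Definition tens_assoc : tens (tens M N) P -> tens M (tens N P) :=
  tens_lift tens_assoc1.
Lemma tens_assocE m n p : tens_assoc ((m \ox n) \ox p) = m \ox (n \ox p).
Proof. by rewrite /tens_assoc (tens_liftE tens_assoc_bal) tens_assoc1E. Qed.
Lemma tens_assoc_hom : bimod_hom tens_assoc.
Proof.
apply: tens_lift_hom; first exact: tens_assoc_bal.
- move=> r + p; apply: (tens_ext (f := fun t => tens_assoc1 (r *: t) p)
    (g := fun t => r *: tens_assoc1 t p)).
  + by move=> t u; rewrite scalerDr tens_assoc1D.
  + by move=> t u; rewrite tens_assoc1D scalerDr.
  by move=> m n; rewrite tpureZ !tens_assoc1E tpureZ.
- move=> + p r; apply: (tens_ext (f := fun t => tens_assoc1 t (p <*: r))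
    (g := fun t => tens_assoc1 t p <*: r)).
  + exact: tens_assoc1D.
  + by move=> t u; rewrite tens_assoc1D ractDl.
  by move=> m n; rewrite !tens_assoc1E !tpure_ract.
Qed.

Fact tens_unassoc_bal1 (m : M) :
  balanced (fun (n : N) (p : P) => (m \ox n) \ox p).
Proof.
split=> [p n n'|n p p'|n r p].
- by rewrite tpureDr tpureDl.
- by rewrite tpureDr.
- by rewrite -tpure_ract tpure_bal.
Qed.
Definition tens_unassoc1 (m : M) (t : tens N P) : tens (tens M N) P :=
  tens_lift (fun (n : N) (p : P) => (m \ox n) \ox p) t.
Lemma tens_unassoc1E m n p : tens_unassoc1 m (n \ox p) = (m \ox n) \ox p.
Proof. exact: (tens_liftE (tens_unassoc_bal1 _)). Qed.
Lemma tens_unassoc1D m : {morph tens_unassoc1 m : t u / t + u}.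
Proof. exact: (tens_liftD (tens_unassoc_bal1 m)). Qed.
Fact tens_unassoc_bal : balanced tens_unassoc1.
Proof.
split=> [t m m'|m|m r t]; last 1 first.
- move: t; apply: (tens_ext (f := tens_unassoc1 (m <*: r))
    (g := fun t => tens_unassoc1 m (r *: t))).
  + exact: tens_unassoc1D.
  + by move=> t u; rewrite scalerDr tens_unassoc1D.
  by move=> n p; rewrite tpureZ !tens_unassoc1E tpure_bal.
- move: t; apply: (tens_ext (f := tens_unassoc1 (m + m'))
    (g := fun t => tens_unassoc1 m t + tens_unassoc1 m' t)).
  + exact: tens_unassoc1D.
  + by move=> t u; rewrite !tens_unassoc1D addrACA.
  by move=> n p; rewrite !tens_unassoc1E !tpureDl.
- exact: tens_unassoc1D.
Qed.
Definition tens_unassoc : tens M (tens N P) -> tens (tens M N) P :=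
  tens_lift tens_unassoc1.
Lemma tens_unassocE m n p : tens_unassoc (m \ox (n \ox p)) = (m \ox n) \ox p.
Proof. by rewrite /tens_unassoc (tens_liftE tens_unassoc_bal) tens_unassoc1E. Qed.
Lemma tens_unassocD : {morph tens_unassoc : t u / t + u}.
Proof. exact: (tens_liftD tens_unassoc_bal). Qed.

Lemma tens_ext3l (V : zmodType) (f g : tens (tens M N) P -> V) :
  {morph f : t u / t + u} -> {morph g : t u / t + u} ->
  (forall m n p, f ((m \ox n) \ox p) = g ((m \ox n) \ox p)) -> f =1 g.
Proof.
move=> fD gD fg; apply: tens_ext => // + p.
apply: (tens_ext (f := fun t => f (t \ox p)) (g := fun t => g (t \ox p))) => //.
- by move=> t u; rewrite tpureDl fD.
- by move=> t u; rewrite tpureDl gD.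
Qed.
Lemma tens_ext3r (V : zmodType) (f g : tens M (tens N P) -> V) :
  {morph f : t u / t + u} -> {morph g : t u / t + u} ->
  (forall m n p, f (m \ox (n \ox p)) = g (m \ox (n \ox p))) -> f =1 g.
Proof.
move=> fD gD fg; apply: tens_ext => // m.
apply: (tens_ext (f := fun t => f (m \ox t)) (g := fun t => g (m \ox t))) => //.
- by move=> t u; rewrite tpureDr fD.
- by move=> t u; rewrite tpureDr gD.
Qed.

Lemma tens_assoc_isom : bimod_isom tens_assoc.
Proof.
have [aD _ _] := tens_assoc_hom; split; first exact: tens_assoc_hom.
exists tens_unassoc.
- apply: (tens_ext3l (f := tens_unassoc \o tens_assoc) (g := id)) => //.
    by move=> t u; rewrite /= aD tens_unassocD.
  by move=> m n p; rewrite /= tens_assocE tens_unassocE.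
- apply: (tens_ext3r (f := tens_assoc \o tens_unassoc) (g := id)) => //.
    by move=> t u; rewrite /= tens_unassocD aD.
  by move=> m n p; rewrite /= tens_unassocE tens_assocE.
Qed.
End Assoc.
End HomTheory.
Section Unitors.
Variables (R : pzRingType) (M : bimodType R).
Local Notation R0 := (regularBimod R).

Fact tens_unitl_bal : balanced (fun (r : R0) (m : M) => (r : R) *: m).
Proof.
split=> [m r s|r m n|r s m]; first by rewrite scalerDl.
- by rewrite scalerDr.
- by rewrite scalerA.
Qed.
Lemma tens_unitl : bimod_iso (tens R0 M) M.
Proof.
pose f := tens_lift (fun (r : R0) (m : M) => (r : R) *: m).
have fh : bimod_hom (f : tens R0 M -> M).
  apply: tens_lift_hom; first exact: tens_unitl_bal.
    by move=> r s m; rewrite scalerA.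
  by move=> r m s; rewrite ractZ.
exists f; split=> //; exists (fun m => (1 : R0) \ox m) => [|m].
  apply: (tens_ext (f := fun t => (1 : R0) \ox f t) (g := id)) => //.
    by case: fh => fD _ _ t u; rewrite fD tpureDr.
  move=> r m; rewrite /f (tens_liftE tens_unitl_bal) -tpure_bal.
  by congr tpure; rewrite -[LHS]/(1 * (r : R)) mul1r.
by rewrite /f (tens_liftE tens_unitl_bal) scale1r.
Qed.

Fact tens_unitr_bal : balanced (fun (m : M) (r : R0) => m <*: (r : R)).
Proof.
split=> [r m n|m r s|m r s]; first by rewrite ractDl.
- by rewrite ractDr.
- by rewrite -ractA.
Qed.
Lemma tens_unitr : bimod_iso (tens M R0) M.
Proof.
pose f := tens_lift (fun (m : M) (r : R0) => m <*: (r : R)).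
have fh : bimod_hom (f : tens M R0 -> M).
  apply: tens_lift_hom; first exact: tens_unitr_bal.
    by move=> r m s; rewrite ractZ.
  by move=> m r s; rewrite -ractA.
exists f; split=> //; exists (fun m => m \ox (1 : R0)) => [|m].
  apply: (tens_ext (f := fun t => f t \ox (1 : R0)) (g := id)) => //.
    by case: fh => fD _ _ t u; rewrite fD tpureDl.
  move=> m r; rewrite /f (tens_liftE tens_unitr_bal) tpure_bal.
  by congr tpure; rewrite -[LHS]/((r : R) * 1) mulr1.
by rewrite /f (tens_liftE tens_unitr_bal) ract1.
Qed.
End Unitors.

Definition invertible (R : pzRingType) (M : bimodType R) : Prop :=
  exists N : bimodType R, bimod_iso (tens M N) (regularBimod R) /\
                          bimod_iso (tens N M) (regularBimod R).

(* Pic(R): an element is an isomorphism class of invertible bimodules, i.e. a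
   predicate on bimodules; [P M] means that M represents P, that is P = [M].
   This is not declared as a groupType: bimodType R lives in a larger universe
   than the one of MathComp's algebraic structures, and forcing the two to
   coincide would be inconsistent as rings are themselves bimodules. *)
Record pic (R : pzRingType) := Pic {
  pic_class :> bimodType R -> Prop;
  pic_classP : exists M, invertible M /\ pic_class = bimod_iso M }.

Section Picard.
Variable R : pzRingType.
Implicit Types (M N : bimodType R) (P Q : pic R).
Local Notation R0 := (regularBimod R).

Definition pic_of M (hM : invertible M) : pic R :=
  @Pic R (bimod_iso M) (ex_intro _ M (conj hM erefl)).

Lemma pic_ext P Q : (forall M, P M <-> Q M) -> P = Q.
Proof.
case: P Q => [p hp] [q hq] /= e.
have epq : p = q by apply/funext => M; apply/propext.
by case: _ / epq hq => hq; congr Pic; apply: Prop_irrelevance.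
Qed.

Lemma pic_iso P M N : P M -> P N <-> bimod_iso M N.
Proof.
have [M0 [_ ->]] := pic_classP P => h0; split=> h.
  exact: bimod_iso_trans (bimod_iso_sym h0) h.
exact: bimod_iso_trans h0 h.
Qed.

Lemma pic_inhab P : exists M, P M.
Proof.
have [M [_ e]] := pic_classP P; exists M; rewrite e; exact: bimod_iso_refl.
Qed.

Lemma invertible_iso M N : bimod_iso M N -> invertible M -> invertible N.
Proof.
move=> e [L [h1 h2]]; exists L; split.
  by apply: bimod_iso_trans h1; apply: tens_iso (bimod_iso_sym e) (bimod_iso_refl _).
by apply: bimod_iso_trans h2; apply: tens_iso (bimod_iso_refl _) (bimod_iso_sym e).
Qed.

Lemma pic_invertible P M : P M -> invertible M.
Proof. by have [M0 [h ->]] := pic_classP P => e; apply: invertible_iso h. Qed.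

Lemma tens_assoc_iso M N L :
  bimod_iso (tens (tens M N) L) (tens M (tens N L)).
Proof. by exists (@tens_assoc R M N L); apply: tens_assoc_isom. Qed.

Lemma tens_collapse M M' N N' : bimod_iso (tens N N') R0 ->
  bimod_iso (tens M M') R0 -> bimod_iso (tens (tens M N) (tens N' M')) R0.
Proof.
move=> hN hM; apply: bimod_iso_trans hM.
apply: bimod_iso_trans (tens_assoc_iso _ _ _) _.
apply: tens_iso (bimod_iso_refl _) _.
apply: bimod_iso_trans (bimod_iso_sym (tens_assoc_iso _ _ _)) _.
apply: bimod_iso_trans (tens_iso hN (bimod_iso_refl _)) _.
exact: tens_unitl.
Qed.

Lemma tens_invertible M N : invertible M -> invertible N -> invertible (tens M N).
Proof.
move=> [M' [h1 h2]] [N' [h3 h4]]; exists (tens N' M').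
by split; apply: tens_collapse.
Qed.

Lemma regular_invertible : invertible R0.
Proof. by exists R0; split; apply: tens_unitl. Qed.

Definition pic_one : pic R := pic_of regular_invertible.

Fact pic_mul_subproof P Q : exists M, invertible M /\
  (fun L => exists M N, [/\ P M, Q N & bimod_iso (tens M N) L]) = bimod_iso M.
Proof.
have [M PM] := pic_inhab P; have [N QN] := pic_inhab Q.
exists (tens M N); split.
  by apply: tens_invertible; [exact: pic_invertible PM | exact: pic_invertible QN].
apply/funext => L; apply/propext; split=> [[M' [N' [PM' QN' e]]]|e].
  apply: bimod_iso_trans e; apply: tens_iso.
    exact/(pic_iso _ PM).
  exact/(pic_iso _ QN).
by exists M, N.
Qed.

(* [M][N] = [M (x)_R N] *)
Definition pic_mul P Q : pic R := Pic (pic_mul_subproof P Q).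

Lemma pic_mulE P Q M N : P M -> Q N -> pic_mul P Q (tens M N).
Proof. by move=> PM QN; exists M, N; split=> //; apply: bimod_iso_refl. Qed.

Lemma pic_mulA : associative pic_mul.
Proof.
move=> P Q S; have [M PM] := pic_inhab P; have [N QN] := pic_inhab Q.
have [L SL] := pic_inhab S; apply: pic_ext => X.
rewrite (pic_iso _ (pic_mulE PM (pic_mulE QN SL))).
rewrite (pic_iso _ (pic_mulE (pic_mulE PM QN) SL)).
split; apply: bimod_iso_trans; first exact: tens_assoc_iso.
exact/bimod_iso_sym/tens_assoc_iso.
Qed.

Lemma pic_mul1 : left_id pic_one pic_mul.
Proof.
move=> P; have [M PM] := pic_inhab P; apply: pic_ext => X.
rewrite (pic_iso _ (pic_mulE (bimod_iso_refl R0 : pic_one R0) PM)).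
rewrite (pic_iso _ PM); split; apply: bimod_iso_trans; last exact: tens_unitl.
exact/bimod_iso_sym/tens_unitl.
Qed.

Lemma pic_mulV P : exists Q, pic_mul Q P = pic_one.
Proof.
have [M PM] := pic_inhab P; have [N [h1 h2]] := pic_invertible PM.
have hN : invertible N by exists M.
exists (pic_of hN); apply: pic_ext => X.
rewrite (pic_iso _ (pic_mulE (bimod_iso_refl N : pic_of hN N) PM)) /=.
by split; apply: bimod_iso_trans => //; apply: bimod_iso_sym.
Qed.
End Picard.

Definition central (R : pzRingType) (z : R) : Prop := forall r, z * r = r * z.

Section Endomorphisms.
Variables (R : pzRingType) (M : bimodType R).
Hypothesis hM : invertible M.

Lemma endo_central (f : M -> M) : bimod_hom f ->
  exists2 w : R, central w & forall m, f m = w *: m.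
Proof.
case: hM => N [[phi [hphi [phi' phiK phi'K]]] [psi [hpsi [psi' psiK psi'K]]]] hf.
have [fD fZ fr] := hf.
have [phiD phiZ phir] := hphi; have [psiD psiZ psir] := hpsi.
pose F := tens_map f (@id N); have hF : bimod_hom F by apply: tens_map_hom.
have hphi' := bimod_hom_inv hphi phiK phi'K.
pose E : regularBimod R -> regularBimod R := phi \o F \o phi'.
have hE : bimod_hom E.
  exact: bimod_hom_comp hphi' (bimod_hom_comp hF hphi).
have [ED EZ Er] := hE; pose w : R := E 1.
have EwL (r : R) : E r = w * r.
  by rewrite -[X in E X](mul1r r); apply: (Er 1 r).
have EwR (r : R) : E r = r * w.
  by rewrite -[X in E X](mulr1 r); apply: (EZ r 1).
have cw : central w by move=> r; rewrite -EwL EwR.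
exists w => // m.
pose g x := f x - w *: x.
have g0 x n : (g x) \ox n = 0 :> tens M N.
  have e1 : F (x \ox n) = w *: (x \ox n).
    have [_ phi'Z _] := hphi'.
    have : E (phi (x \ox n)) = w * phi (x \ox n) by apply: EwL.
    rewrite /E /= phiK => /(congr1 phi'); rewrite phiK => ->.
    by rewrite -[w * _]/(w *: (phi _ : regularBimod R)) phi'Z phiK.
  have negl : (- (w *: x)) \ox n = - (w *: (x \ox n)).
    by apply/eqP; rewrite -addr_eq0 tpureZ -tpureDl addNr -(scale0r 0) -tpureZ scale0r.
  by rewrite /g tpureDl negl -e1 /F tens_mapE// subrr.
suff : g m = 0 by move/eqP; rewrite subr_eq0 => /eqP.
have key n b : g m <*: (psi (n \ox b) : R) = 0.
  pose k (x : M) (y : N) : M := x <*: (psi (y \ox b) : R).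
  have kb : balanced k.
    split=> [y x x'|x y y'|x r y]; rewrite /k.
    - by rewrite ractDl.
    - by rewrite tpureDl psiD ractDr.
    - by rewrite -ractA -tpureZ psiZ.
  by rewrite -[LHS]/(k _ _) -(tens_liftE kb) -[pure _ _]/(_ \ox _) g0 tens_lift0.
rewrite -[LHS]ract1 -[X in _ <*: X](psi'K 1) (tens_sum (psi' 1)).
rewrite bimod_hom_sum// ract_sumr big1// => p _; exact: key.
Qed.

Lemma scale_inj (w w' : R) : (forall m : M, w *: m = w' *: m) -> w = w'.
Proof.
case: hM => N [[phi [hphi [phi' phiK phi'K]]] _] e.
have [phiD phiZ _] := hphi.
have et (t : tens M N) : w *: t = w' *: t.
  move: t; apply: tens_ext; try by move=> t u; rewrite scalerDr.
  by move=> m n; rewrite !tpureZ e.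
have := congr1 phi (et (phi' 1)); rewrite !phiZ phi'K.
by rewrite -[LHS]/(w * 1) -[RHS]/(w' * 1) !mulr1.
Qed.
End Endomorphisms.

Section Delta.
Variable R : pzRingType.
Implicit Types (M : bimodType R) (P : pic R).

(* Delta_M z is the central element w such that m z = w m for all m. *)
Definition Delta M (z : R) : R :=
  xget 0 [set w : R | central w /\ forall m : M, m <*: z = w *: m].

Lemma DeltaP M z : invertible M -> central z ->
  central (Delta M z) /\ forall m : M, m <*: z = Delta M z *: m.
Proof.
move=> hM cz; apply: (@xgetPex _ 0 [set w : R | central w /\ _]).
have [|w cw e] := @endo_central R M hM (fun m => m <*: z); last by exists w.
split=> [m n|r m|m r] /=; first by rewrite ractDl.
- by rewrite ractZ.
- by rewrite -!ractA cz.
Qed.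

Lemma Delta_unique M z w : invertible M -> central z ->
  (forall m : M, m <*: z = w *: m) -> Delta M z = w.
Proof.
move=> hM cz e; apply: (scale_inj hM) => m.
by rewrite -e (DeltaP hM cz).2.
Qed.

Lemma Delta_iso M N z : bimod_iso M N -> invertible M -> central z ->
  Delta N z = Delta M z.
Proof.
move=> e hM cz; have hN := invertible_iso e hM.
case: e => f [[fD fZ fr] [g fK gK]]; apply: Delta_unique => // n.
by rewrite -(gK n) -fr (DeltaP hM cz).2 fZ.
Qed.

Definition pic_Delta P : R -> R := Delta (projT1 (cid (pic_inhab P))).

Lemma pic_DeltaE P M z : P M -> central z -> pic_Delta P z = Delta M z.
Proof.
move=> PM cz; rewrite /pic_Delta; case: cid => N /= PN.
by apply: Delta_iso => //; [exact/(pic_iso _ PM) | exact: pic_invertible PM].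
Qed.

Lemma pic_DeltaP P M z : P M -> central z ->
  central (pic_Delta P z) /\ forall m : M, m <*: z = pic_Delta P z *: m.
Proof. by move=> PM cz; rewrite (pic_DeltaE PM cz); apply/DeltaP/cz/(pic_invertible PM). Qed.

Lemma pic_Delta_unique P M z w : P M -> central z ->
  (forall m : M, m <*: z = w *: m) -> pic_Delta P z = w.
Proof.
move=> PM cz; rewrite (pic_DeltaE PM cz); apply: Delta_unique => //.
exact: pic_invertible PM.
Qed.
End Delta.

Section CentralUnits.
Variable R : pzRingType.

Definition central_unit : {pred R} := fun u =>
  `[< central u /\ exists2 v, central v & u * v = 1 >].

Definition UZ := {u : R | central_unit u}.
HB.instance Definition _ := SubChoice.on UZ.

Lemma UZ_central (u : UZ) : central (val u).
Proof. by case: u => u /= /asboolP[]. Qed.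

Definition UZ_inv_val (u : UZ) : R := xget 0 [set v : R | central v /\ val u * v = 1].
Lemma UZ_inv_valP (u : UZ) : central (UZ_inv_val u) /\ val u * UZ_inv_val u = 1.
Proof.
apply: (@xgetPex _ 0 [set v : R | central v /\ val u * v = 1]).
by case: u => u /= /asboolP[_ [v cv e]]; exists v.
Qed.

Fact UZ_one_subproof : central_unit (1 : R).
Proof.
apply/asboolP; split; last exists 1 => //; rewrite ?mulr1//.
  by move=> r; rewrite mul1r mulr1.
by move=> r; rewrite mul1r mulr1.
Qed.
Fact UZ_mul_subproof (u v : UZ) : central_unit (val u * val v).
Proof.
have cM (x y : R) : central x -> central y -> central (x * y).
  by move=> cx cy r; rewrite -mulrA cy mulrA cx mulrA.
have [[c1 e1] [c2 e2]] := (UZ_inv_valP u, UZ_inv_valP v).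
apply/asboolP; split; first by apply: cM; apply: UZ_central.
exists (UZ_inv_val v * UZ_inv_val u); first exact: cM.
by rewrite mulrA -[val u * _ * _]mulrA e2 mulr1.
Qed.
Fact UZ_inv_subproof (u : UZ) : central_unit (UZ_inv_val u).
Proof.
have [c1 e1] := UZ_inv_valP u; apply/asboolP; split=> //.
by exists (val u); [exact: UZ_central | rewrite c1].
Qed.

Definition UZ_one : UZ := Sub 1 UZ_one_subproof.
Definition UZ_mul (u v : UZ) : UZ := Sub (val u * val v) (UZ_mul_subproof u v).
Definition UZ_inv (u : UZ) : UZ := Sub (UZ_inv_val u) (UZ_inv_subproof u).

Fact UZ_mulA : associative UZ_mul.
Proof. by move=> u v w; apply: val_inj; rewrite /= mulrA. Qed.
Fact UZ_mul1 : left_id UZ_one UZ_mul.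
Proof. by move=> u; apply: val_inj; rewrite /= mul1r. Qed.
Fact UZ_mulr1 : right_id UZ_one UZ_mul.
Proof. by move=> u; apply: val_inj; rewrite /= mulr1. Qed.
Fact UZ_mulV : left_inverse UZ_one UZ_inv UZ_mul.
Proof. by move=> u; apply: val_inj; rewrite /= -UZ_central (UZ_inv_valP u).2. Qed.
Fact UZ_mulrV : right_inverse UZ_one UZ_inv UZ_mul.
Proof. by move=> u; apply: val_inj; rewrite /= (UZ_inv_valP u).2. Qed.
HB.instance Definition _ :=
  isGroup.Build UZ UZ_mulA UZ_mul1 UZ_mulr1 UZ_mulV UZ_mulrV.

Lemma UZ_mulC : commutative ( *%g : UZ -> UZ -> UZ).
Proof. by move=> u v; apply: val_inj; rewrite /= UZ_central. Qed.

Lemma UZ_valM (u v : UZ) : val (u * v)%g = val u * val v.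
Proof. by []. Qed.
Lemma UZ_val1 : val (1%g : UZ) = 1.
Proof. by []. Qed.

(* ^P u = Delta_M(u), for any M representing P *)
Fact pic_act_subproof (P : pic R) (u : UZ) : central_unit (pic_Delta P (val u)).
Proof.
have [M PM] := pic_inhab P; have cu := UZ_central u.
have [c1 e1] := pic_DeltaP PM cu; have [cv ev] := UZ_inv_valP u.
have [c2 e2] := pic_DeltaP PM cv.
apply/asboolP; split=> //; exists (pic_Delta P (UZ_inv_val u)) => //.
apply: (scale_inj (pic_invertible PM)) => m.
by rewrite -scalerA -e2 -ractZ -e1 -ractA ev ract1 scale1r.
Qed.
Definition pic_act (P : pic R) (u : UZ) : UZ :=
  Sub (pic_Delta P (val u)) (pic_act_subproof P u).

Lemma pic_actE (P : pic R) (M : bimodType R) (u : UZ) (m : M) : P M ->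
  m <*: val u = val (pic_act P u) *: m.
Proof. by move=> PM; have [_ ->] := pic_DeltaP PM (UZ_central u). Qed.

Lemma pic_act_unique (P : pic R) (M : bimodType R) (u v : UZ) : P M ->
  (forall m : M, m <*: val u = val v *: m) -> pic_act P u = v.
Proof.
by move=> PM e; apply: val_inj; apply: (pic_Delta_unique PM) => //; apply: UZ_central.
Qed.

Lemma pic_actM (P : pic R) : {morph pic_act P : u v / (u * v)%g}.
Proof.
move=> u v; have [M PM] := pic_inhab P; apply: (pic_act_unique PM) => m.
by rewrite !UZ_valM ractA !(pic_actE _ _ PM) scalerA UZ_central.
Qed.
Lemma pic_act1 (P : pic R) : pic_act P 1%g = 1%g.
Proof.
have [M PM] := pic_inhab P; apply: (pic_act_unique PM) => m.
by rewrite UZ_val1 ract1 scale1r.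
Qed.
End CentralUnits.
(* Normalized cochains of a group H relative to a subgroup D, with values in
   U(Z(R)), for the action of H on U(Z(R)) given by rho : H -> Pic(R). *)
Definition cochain (H : groupType) (R : pzRingType) (n : nat) :=
  n.-tuple H -> UZ R.

Section CochainGroup.
Variables (H : groupType) (R : pzRingType) (n : nat).
Implicit Types c : cochain H R n.
HB.instance Definition _ := Choice.copy (cochain H R n) (n.-tuple H -> UZ R).
Definition cochain_one : cochain H R n := fun=> 1%g.
Definition cochain_mul c c' : cochain H R n := fun x => (c x * c' x)%g.
Definition cochain_inv c : cochain H R n := fun x => ((c x)^-1)%g.
Fact cochain_mulA : associative cochain_mul.
Proof. by move=> a b c; apply/funext => x; apply: mulgA. Qed.
Fact cochain_mul1 : left_id cochain_one cochain_mul.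
Proof. by move=> a; apply/funext => x; apply: mul1g. Qed.
Fact cochain_mulr1 : right_id cochain_one cochain_mul.
Proof. by move=> a; apply/funext => x; apply: mulg1. Qed.
Fact cochain_mulV : left_inverse cochain_one cochain_inv cochain_mul.
Proof. by move=> a; apply/funext => x; apply: mulVg. Qed.
Fact cochain_mulrV : right_inverse cochain_one cochain_inv cochain_mul.
Proof. by move=> a; apply/funext => x; apply: mulgV. Qed.
HB.instance Definition _ := isGroup.Build (cochain H R n)
  cochain_mulA cochain_mul1 cochain_mulr1 cochain_mulV cochain_mulrV.
Lemma cochain_mulE c c' x : (c * c')%g x = (c x * c' x)%g.
Proof. by []. Qed.
Lemma cochain_invE c x : (c^-1)%g x = ((c x)^-1)%g.
Proof. by []. Qed.
Lemma cochain_mulC : commutative ( *%g : cochain H R n -> _).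
Proof. by move=> a b; apply/funext => x; apply: UZ_mulC. Qed.
Lemma cochain_mulACA (a b c d : cochain H R n) :
  (a * b * (c * d) = a * c * (b * d))%g.
Proof.
by rewrite -!mulgA; congr (_ * _)%g; rewrite !mulgA; congr (_ * _)%g;
   apply: cochain_mulC.
Qed.
End CochainGroup.

Section Cohomology.
Variables (H : groupType) (D : groupClosed H) (R : pzRingType).
Variable rho : H -> pic R.

(* The faces of (x_0, ..., x_n): multiply x_i and x_(i+1), or drop x_n. *)
Definition face_mul n (i : 'I_n) (x : n.+1.-tuple H) : n.-tuple H :=
  [tuple if (j < i)%N then tnth x (widen_ord (leqnSn n) j)
         else if j == i then (tnth x (widen_ord (leqnSn n) j) *
                              tnth x (lift ord0 j))%g
         else tnth x (lift ord0 j) | j < n].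
Definition face_last n (x : n.+1.-tuple H) : n.-tuple H :=
  [tuple tnth x (widen_ord (leqnSn n) j) | j < n].

Definition expsign (k : nat) (u : UZ R) : UZ R := if odd k then (u^-1)%g else u.

(* The usual differential:
   (d c)(x_0, ..., x_n) = ^(x_0) c(x_1, ..., x_n)
      * prod_(i < n) c(..., x_i x_(i+1), ...)^((-1)^(i+1))
      * c(x_0, ..., x_(n-1))^((-1)^(n+1)). *)
Definition differential n (c : cochain H R n) : cochain H R n.+1 := fun x =>
  (pic_act (rho (thead x)) (c [tuple of behead x]) *
   (\prod_(i < n) expsign i.+1 (c (face_mul i x))) *
   expsign n.+1 (c (face_last x)))%g.

(* For n = 0 the second clause, applied to the empty tuple, says c = 1. *)
Definition rel_cochain n (c : cochain H R n) : Prop :=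
  (forall x : n.-tuple H, 1%g \in tval x -> c x = 1%g) /\
  (forall x : n.-tuple H, {subset tval x <= D} -> c x = 1%g).

Definition rel_coboundary n : cochain H R n -> Prop :=
  match n with
  | 0 => fun c => c = 1%g
  | m.+1 => fun c => exists2 b : cochain H R m, rel_cochain b & c = differential b
  end.

Definition rel_cocycle n : {pred cochain H R n} := fun c =>
  `[< rel_cochain c /\ differential c = 1%g >].

Lemma UZ_mulACA (a b c d : UZ R) : (a * b * (c * d) = a * c * (b * d))%g.
Proof. by rewrite -!mulgA; congr (_ * _)%g; rewrite !mulgA; congr (_ * _)%g; apply: UZ_mulC. Qed.

Lemma expsignM k : {morph expsign k : u v / (u * v)%g}.
Proof. by move=> u v; rewrite /expsign; case: odd => //; rewrite invgM UZ_mulC. Qed.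

Lemma expsign1 k : expsign k 1%g = 1%g.
Proof. by rewrite /expsign invg1 if_same. Qed.

Lemma differentialM n : {morph @differential n : c c' / (c * c')%g}.
Proof.
move=> c c'; apply/funext => x; rewrite cochain_mulE /differential.
rewrite cochain_mulE pic_actM !expsignM.
under eq_bigr do rewrite cochain_mulE expsignM.
rewrite prodgM_commute; last by move=> i j _ _; apply: UZ_mulC.
by rewrite [X in (X * _)%g = _]UZ_mulACA; apply: UZ_mulACA.
Qed.

Lemma differential1 n : @differential n 1%g = 1%g.
Proof.
by apply: (mulgI (differential 1%g)); rewrite -differentialM !mulg1.
Qed.

Lemma differentialV n (c : cochain H R n) :
  differential (c^-1)%g = ((differential c)^-1)%g.
Proof.
apply: (mulgI (differential c)); rewrite -differentialM !mulgV.
exact: differential1.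
Qed.

Lemma rel_cochain1 n : @rel_cochain n 1%g.
Proof. by []. Qed.
Lemma rel_cochainM n (c c' : cochain H R n) :
  rel_cochain c -> rel_cochain c' -> rel_cochain (c * c')%g.
Proof.
move=> [h1 h2] [h3 h4]; split=> x hx; rewrite cochain_mulE.
  by rewrite h1// h3// mulg1.
by rewrite h2// h4// mulg1.
Qed.
Lemma rel_cochainV n (c : cochain H R n) : rel_cochain c -> rel_cochain (c^-1)%g.
Proof.
move=> [h1 h2]; split=> x hx; rewrite cochain_invE.
  by rewrite h1// invg1.
by rewrite h2// invg1.
Qed.

Lemma rel_coboundary1 n : @rel_coboundary n 1%g.
Proof. by case: n => //= n; exists 1%g; rewrite ?differential1. Qed.
Lemma rel_coboundaryM n (c c' : cochain H R n) :
  rel_coboundary c -> rel_coboundary c' -> rel_coboundary (c * c')%g.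
Proof.
case: n c c' => [c c' -> ->|n c c' [b rb ->] [b' rb' ->]] /=.
  by rewrite mulg1.
by exists (b * b')%g; [apply: rel_cochainM | rewrite differentialM].
Qed.
Lemma rel_coboundaryV n (c : cochain H R n) :
  rel_coboundary c -> rel_coboundary (c^-1)%g.
Proof.
case: n c => [c ->|n c [b rb ->]] /=; first by rewrite invg1.
by exists (b^-1)%g; [apply: rel_cochainV | rewrite differentialV].
Qed.

Fact rel_cocycle_closed n : group_closed (@rel_cocycle n).
Proof.
split; first by apply/asboolP; rewrite differential1.
move=> c c' /asboolP[h e] /asboolP[h' e']; apply/asboolP; split.
  by apply/rel_cochainM/rel_cochainV.
by rewrite differentialM differentialV e e' mulgV.
Qed.

(* Z^n_rho(H, D; U(Z(R))), with [rel_cocycle_closed] making it a group *)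
Definition relZ n := {c : cochain H R n | rel_cocycle c}.
HB.instance Definition _ n := SubChoice.on (relZ n).
HB.instance Definition _ n := SubChoice_isSubGroup.Build
  (cochain H R n) (@rel_cocycle n) (relZ n) (@rel_cocycle_closed n).

Definition relZ_fun n (c : relZ n) : n.-tuple H -> UZ R := val c.
Coercion relZ_fun : relZ >-> Funclass.

Lemma relZP n (c : relZ n) : rel_cochain (val c) /\ differential (val c) = 1%g.
Proof. by case: c => c /= /asboolP. Qed.

(* Cocycles are cohomologous when their quotient lies in the image of the
   relative (n-1)-cochains; relH n is H^n_rho(H, D; U(Z(R))). *)
Definition cohomologous n : rel (relZ n) := fun c c' =>
  `[< rel_coboundary (val c / val c')%g >].
Fact cohomologous_refl n : reflexive (@cohomologous n).
Proof. by move=> c; apply/asboolP; rewrite mulgV; apply: rel_coboundary1. Qed.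
Fact cohomologous_sym n : symmetric (@cohomologous n).
Proof.
by move=> c c'; apply/idP/idP => /asboolP/rel_coboundaryV h; apply/asboolP;
   move: h; rewrite invgF.
Qed.
Fact cohomologous_trans n : transitive (@cohomologous n).
Proof.
move=> b a c /asboolP h1 /asboolP h2; apply/asboolP.
have := rel_coboundaryM h1 h2; by rewrite mulgA mulgVK.
Qed.
Canonical cohomologous_equiv n := EquivRel (@cohomologous n)
  (@cohomologous_refl n) (@cohomologous_sym n) (@cohomologous_trans n).

Definition relH n := {eq_quot (cohomologous_equiv n)}.
HB.instance Definition _ n := Choice.on (relH n).
HB.instance Definition _ n := EqQuotient.on (relH n).

Definition relH_class n (c : relZ n) : relH n := \pi_(relH n) c.

Lemma relH_classP n (c c' : relZ n) :
  relH_class c = relH_class c' <-> rel_coboundary (val c / val c')%g.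
Proof. by split=> [/eqquotP/asboolP|h] //; apply/eqquotP/asboolP. Qed.

Lemma relH_reprK n (k : relH n) : relH_class (repr k) = k.
Proof. exact: reprK. Qed.

Definition relH_one n : relH n := relH_class 1%g.
Definition relH_mul n (k l : relH n) : relH n := relH_class (repr k * repr l)%g.
Definition relH_inv n (k : relH n) : relH n := relH_class ((repr k)^-1)%g.

Lemma relH_mul_class n (c c' : relZ n) :
  relH_mul (relH_class c) (relH_class c') = relH_class (c * c')%g.
Proof.
apply/relH_classP; rewrite !valM.
have /relH_classP h1 := relH_reprK (relH_class c).
have /relH_classP h2 := relH_reprK (relH_class c').
have := rel_coboundaryM h1 h2; rewrite [X in rel_coboundary X]cochain_mulACA.
by rewrite [X in (_ * X)%g]cochain_mulC -invgM.
Qed.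

Fact relH_mulA n : associative (@relH_mul n).
Proof.
move=> a b c; rewrite -(relH_reprK a) -(relH_reprK b) -(relH_reprK c).
by rewrite !relH_mul_class mulgA.
Qed.
Fact relH_mul1 n : left_id (@relH_one n) (@relH_mul n).
Proof. by move=> a; rewrite -(relH_reprK a) relH_mul_class mul1g. Qed.
Fact relH_mulr1 n : right_id (@relH_one n) (@relH_mul n).
Proof. by move=> a; rewrite -(relH_reprK a) relH_mul_class mulg1. Qed.
Fact relH_mulV n : left_inverse (@relH_one n) (@relH_inv n) (@relH_mul n).
Proof. by move=> a; rewrite -{2}(relH_reprK a) relH_mul_class mulVg. Qed.
Fact relH_mulrV n : right_inverse (@relH_one n) (@relH_inv n) (@relH_mul n).
Proof. by move=> a; rewrite -{1}(relH_reprK a) relH_mul_class mulgV. Qed.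
HB.instance Definition _ n := isGroup.Build (relH n)
  (@relH_mulA n) (@relH_mul1 n) (@relH_mulr1 n) (@relH_mulV n) (@relH_mulrV n).

Lemma relH_classM n (c c' : relZ n) :
  relH_class (c * c')%g = (relH_class c * relH_class c')%g.
Proof. by rewrite -relH_mul_class. Qed.

Lemma differential1E (c : cochain H R 1) x y : differential c [tuple x; y] =
  (pic_act (rho x) (c [tuple y]) * (c [tuple (x * y)%g])^-1 * c [tuple x])%g.
Proof.
rewrite /differential big_ord_recl big_ord0 mulg1 /expsign /=.
by congr (_ * (c _)^-1 * c _)%g; first congr (pic_act _ (c _));
  apply: eq_from_tnth => -[[|i] hi] //; rewrite ?tnth_mktuple //.
Qed.

Lemma differential2E (c : cochain H R 2) x y z :
  differential c [tuple x; y; z] =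
  (pic_act (rho x) (c [tuple y; z]) * (c [tuple (x * y)%g; z])^-1 *
   c [tuple x; (y * z)%g] * (c [tuple x; y])^-1)%g.
Proof.
rewrite /differential !big_ord_recl big_ord0 mulg1 /expsign /= mulgA.
by congr (_ * (c _)^-1 * c _ * (c _)^-1)%g; first congr (pic_act _ (c _));
  apply: eq_from_tnth => -[[|[|i]] hi] //; rewrite ?tnth_mktuple //.
Qed.

Lemma differential3E (c : cochain H R 3) x y z t :
  differential c [tuple x; y; z; t] =
  (pic_act (rho x) (c [tuple y; z; t]) * (c [tuple (x * y)%g; z; t])^-1 *
   c [tuple x; (y * z)%g; t] * (c [tuple x; y; (z * t)%g])^-1 *
   c [tuple x; y; z])%g.
Proof.
rewrite /differential !big_ord_recl big_ord0 mulg1 /expsign /= !mulgA.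
by congr (_ * (c _)^-1 * c _ * (c _)^-1 * c _)%g;
  first congr (pic_act _ (c _));
  apply: eq_from_tnth => -[[|[|[|i]]] hi] //; rewrite ?tnth_mktuple //.
Qed.
End Cohomology.
(* A homogeneous component of A, as a bimodule over a ring R mapped into the
   principal component of A by f. *)
Section ComponentBimodule.
Variables (H : groupType) (D : groupClosed H) (A : gradedRing D).
Variables (R : pzRingType) (f : {rmorphism R -> A}).
Hypothesis f1 : forall r, f r \in gcomp A 1%g.
Variable h : H.

Definition bcar of (forall r, f r \in gcomp A 1%g) := gcar A h.
Local Notation M := (bcar f1).
HB.instance Definition _ := GRing.Zmodule.on M.

Fact comp_scale_subproof r (m : M) : gcomp_pred h (f r * val m).
Proof. by have := gcompM A (f1 r) (valP m); rewrite mul1g. Qed.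
Fact comp_ract_subproof (m : M) r : gcomp_pred h (val m * f r).
Proof. by have := gcompM A (valP m) (f1 r); rewrite mulg1. Qed.
Definition comp_scale r (m : M) : M := Sub (f r * val m) (comp_scale_subproof r m).
Definition comp_ract (m : M) r : M := Sub (val m * f r) (comp_ract_subproof m r).

Fact comp_scaleA r s m : comp_scale r (comp_scale s m) = comp_scale (r * s) m.
Proof. by apply: val_inj; rewrite /= rmorphM mulrA. Qed.
Fact comp_scale1 : left_id 1 comp_scale.
Proof. by move=> m; apply: val_inj; rewrite /= rmorph1 mul1r. Qed.
Fact comp_scaleDr : right_distributive comp_scale +%R.
Proof. by move=> r m n; apply: val_inj; rewrite /= mulrDr. Qed.
Fact comp_scaleDl m : {morph comp_scale^~ m : r s / r + s}.
Proof. by move=> r s; apply: val_inj; rewrite /= rmorphD mulrDl. Qed.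
HB.instance Definition _ := GRing.Zmodule_isLmodule.Build R M
  comp_scaleA comp_scale1 comp_scaleDr comp_scaleDl.

Fact comp_ractDl r : {morph comp_ract ^~ r : m n / m + n}.
Proof. by move=> m n; apply: val_inj; rewrite /= mulrDl. Qed.
Fact comp_ractDr m : {morph comp_ract m : r s / r + s}.
Proof. by move=> r s; apply: val_inj; rewrite /= rmorphD mulrDr. Qed.
Fact comp_ract1 m : comp_ract m 1 = m.
Proof. by apply: val_inj; rewrite /= rmorph1 mulr1. Qed.
Fact comp_ractA m r s : comp_ract m (r * s) = comp_ract (comp_ract m r) s.
Proof. by apply: val_inj; rewrite /= rmorphM mulrA. Qed.
Fact comp_ractZ r (m : M) s : comp_ract (r *: m) s = r *: comp_ract m s.
Proof. by apply: val_inj; rewrite /= mulrA. Qed.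

Definition compBimod : bimodType R :=
  @Bimod R M comp_ract comp_ractDl comp_ractDr comp_ract1 comp_ractA comp_ractZ.
End ComponentBimodule.

(* S_g as a bimodule over R = S_e *)
Definition component (H : groupType) (D : groupClosed H) (S : gradedRing D)
    (g : H) : bimodType (principal S) :=
  compBimod (f := (val : principal S -> S)) (fun r => valP r) g.

Definition bcast (T : Type) (R : pzRingType) (M : T -> bimodType R) (x y : T)
  (e : x = y) (m : M x) : M y := ecast z (M z) e m.
Arguments bcast {T R} M {x y} e m.

Section CharacteristicClass.
Variables (Gh : groupType) (G : groupClosed Gh) (S : gradedRing G).
Local Notation R := (principal S).
Variable phat : Gh -> pic R.

(* The choices entering the definition of the characteristic class.  The
   equalities M_g = S_g, g in G, are replaced by specified isomorphisms
   [cd_id g], through which the conditions on mu_(g,h) and on mu_(e,x) and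
   mu_(x,e) are expressed (M_e = S_e = R); [cd_id g] is irrelevant for g
   outside G.  [bcast] only transports along 1 * x = x and x * 1 = x. *)
Record charData := CharData {
  cd_mod :> Gh -> bimodType R;
  cd_pic : forall x, phat x (cd_mod x);
  cd_id : forall g, component S g -> cd_mod g;
  cd_id_isom : forall g, g \in G -> bimod_isom (@cd_id g);
  cd_mu : forall x y, tens (cd_mod x) (cd_mod y) -> cd_mod (x * y)%g;
  cd_mu_isom : forall x y, bimod_isom (@cd_mu x y);
  cd_mu_mul : forall g h, g \in G -> h \in G ->
    forall (s : component S g) (t : component S h),
    cd_mu (cd_id s \ox cd_id t) = cd_id (gmul s t : component S (g * h)%g);
  cd_mu1l : forall x (r : R) (m : cd_mod x),
    cd_mu (@cd_id 1%g r \ox m) = bcast cd_mod (esym (mul1g x)) (r *: m);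
  cd_mu1r : forall x (m : cd_mod x) (r : R),
    cd_mu (m \ox @cd_id 1%g r) = bcast cd_mod (esym (mulg1 x)) (m <*: r) }.

Variable M : charData.
Local Notation mu := (cd_mu (c := M)).

(* The unique alpha(x,y,z) in U(Z(R)) with
   mu_(xy,z) (mu_(x,y) (x) id) = alpha(x,y,z) mu_(x,yz) (id (x) mu_(y,z)),
   where M_(x(yz)) is identified with M_((xy)z). *)
Definition is_alpha x y z (u : UZ R) : Prop :=
  forall (m : M x) (n : M y) (p : M z),
  mu (mu (m \ox n) \ox p) =
  bcast M (mulgA x y z) (val u *: mu (m \ox mu (n \ox p))).

Definition alpha x y z : UZ R := xget 1%g [set u | is_alpha x y z u].

Lemma bcast_isom x y (e : x = y) : bimod_isom (@bcast _ _ M x y e).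
Proof. by case: _ / e; split=> //; exists id. Qed.

Lemma auto_UZ (N : bimodType R) (f : N -> N) : invertible N -> bimod_isom f ->
  exists u : UZ R, forall m, f m = val u *: m.
Proof.
move=> hN If; have [g [Ig fK gK]] := bimod_isom_inv If.
have [w cw ew] := endo_central hN If.1; have [v cv ev] := endo_central hN Ig.1.
have hw : central_unit w.
  apply/asboolP; split=> //; exists v => //; apply: (scale_inj hN) => m.
  by rewrite -scalerA -ev -ew gK scale1r.
by exists (Sub w hw : UZ R) => m; rewrite ew.
Qed.

Definition mu_left x y z : tens (tens (M x) (M y)) (M z) -> M (x * y * z)%g :=
  @cd_mu M (x * y)%g z \o tens_map (@cd_mu M x y) id.
Definition mu_right x y z : tens (tens (M x) (M y)) (M z) -> M (x * y * z)%g :=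
  @bcast _ _ M _ _ (mulgA x y z) \o (@cd_mu M x (y * z)%g \o
   (tens_map id (@cd_mu M y z) \o @tens_assoc R (M x) (M y) (M z))).

Lemma id_isom (N : bimodType R) : bimod_isom (@id N).
Proof. by split=> //; exists id. Qed.

Lemma mu_left_isom x y z : bimod_isom (@mu_left x y z).
Proof.
apply: bimod_isom_comp (cd_mu_isom _ _ _); apply: tens_map_isom (id_isom _).
exact: cd_mu_isom.
Qed.
Lemma mu_right_isom x y z : bimod_isom (@mu_right x y z).
Proof.
apply: bimod_isom_comp (bcast_isom _); apply: bimod_isom_comp (cd_mu_isom _ _ _).
apply: bimod_isom_comp (tens_assoc_isom _ _ _) _.
by apply: tens_map_isom (id_isom _) _; apply: cd_mu_isom.
Qed.
Lemma mu_leftE x y z (m : M x) (n : M y) (p : M z) :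
  mu_left ((m \ox n) \ox p) = mu (mu (m \ox n) \ox p).
Proof.
by rewrite /mu_left /= tens_mapE//; case: (cd_mu_isom M x y).
Qed.
Lemma mu_rightE x y z (m : M x) (n : M y) (p : M z) :
  mu_right ((m \ox n) \ox p) = bcast M (mulgA x y z) (mu (m \ox mu (n \ox p))).
Proof.
by rewrite /mu_right /= tens_assocE tens_mapE//; case: (cd_mu_isom M y z).
Qed.

Lemma is_alphaP x y z u : is_alpha x y z u <->
  forall t, @mu_left x y z t = val u *: @mu_right x y z t.
Proof.
have [cD cZ cr] := (bcast_isom (mulgA x y z)).1.
split=> [h|h m n p]; last by rewrite -mu_leftE h mu_rightE cZ.
apply: (@tens_ext3l R (M x) (M y) (M z) _ (@mu_left x y z)
          (fun t => val u *: mu_right t)).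
- by case: (mu_left_isom x y z) => -[].
- by move=> s t; case: (mu_right_isom x y z) => -[-> _ _ _]; rewrite scalerDr.
- by move=> m n p; rewrite mu_leftE h mu_rightE cZ.
Qed.

Lemma cd_invertible x : invertible (M x).
Proof. exact: pic_invertible (cd_pic M x). Qed.

Lemma alphaP x y z : is_alpha x y z (alpha x y z).
Proof.
apply: (@xgetPex _ 1%g [set u | is_alpha x y z u]).
have [g [Ig gK Kg]] := bimod_isom_inv (mu_right_isom x y z).
have [u hu] := auto_UZ (cd_invertible _)
  (bimod_isom_comp Ig (mu_left_isom x y z)).
by exists u; apply/is_alphaP => t; rewrite -hu /= gK.
Qed.

Lemma alpha_unique x y z u : is_alpha x y z u -> alpha x y z = u.
Proof.
move=> /is_alphaP hu; have /is_alphaP ha := @alphaP x y z.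
apply: val_inj; apply: (scale_inj (cd_invertible (x * y * z)%g)) => m.
have [g [_ _ gK]] := bimod_isom_inv (mu_right_isom x y z).
by rewrite -(gK m) -ha hu.
Qed.

(* The multiplication maps with target M_z for any z equal to xy. *)
Definition cdot x y z (e : (x * y)%g = z) (m : M x) (n : M y) : M z :=
  bcast M e (mu (m \ox n)).

Lemma bcast_irr x y (e e' : x = y) : @bcast _ _ M x y e =1 bcast M e'.
Proof. by move=> m; rewrite (eq_irrelevance e e'). Qed.

Lemma bcast_trans x y z (e : x = y) (e' : y = z) m :
  bcast M e' (bcast M e m) = bcast M (etrans e e') m.
Proof. by case: _ / e'; case: _ / e. Qed.

Lemma bcastZ x y (e : x = y) r m : bcast M e (r *: m) = r *: bcast M e m.
Proof. by case: _ / e. Qed.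

Lemma cdotZl x y z (e : (x * y)%g = z) r m n :
  cdot e (r *: m) n = r *: cdot e m n.
Proof.
rewrite /cdot -bcastZ; have [[_ cZ _] _] := cd_mu_isom M x y.
by rewrite -cZ tpureZ.
Qed.

Lemma cdotZr x y z (e : (x * y)%g = z) (u : UZ R) m n :
  cdot e m (val u *: n) = val (pic_act (phat x) u) *: cdot e m n.
Proof. by rewrite -cdotZl -(pic_actE _ _ (cd_pic M x)) /cdot tpure_bal. Qed.

Lemma cdotA x y z xy yz w (e1 : (x * y)%g = xy) (e2 : (xy * z)%g = w)
    (e3 : (y * z)%g = yz) (e4 : (x * yz)%g = w) m n p :
  cdot e2 (cdot e1 m n) p = val (alpha x y z) *: cdot e4 m (cdot e3 n p).
Proof.
case: _ / e1 in e2 *; case: _ / e3 in e4 *; rewrite /cdot /=.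
rewrite (@alphaP x y z m n p) bcast_trans bcastZ; congr (_ *: _).
exact: bcast_irr.
Qed.

Lemma cdot_castl x x' y z (d : x = x') (e : (x * y)%g = z)
    (e' : (x' * y)%g = z) m n :
  cdot e' (bcast M d m) n = cdot e m n.
Proof. by case: _ / d in e' *; rewrite /cdot; apply: bcast_irr. Qed.
Lemma cdot_castr x y y' z (d : y = y') (e : (x * y)%g = z)
    (e' : (x * y')%g = z) m n :
  cdot e' m (bcast M d n) = cdot e m n.
Proof. by case: _ / d in e' *; rewrite /cdot; apply: bcast_irr. Qed.

Lemma cdot_id_l x y (e : (1 * x)%g = y) (e' : x = y) (r : R) m :
  cdot e (@cd_id M 1%g r) m = bcast M e' (r *: m).
Proof. by rewrite /cdot cd_mu1l bcast_trans; apply: bcast_irr. Qed.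
Lemma cdot_id_r x y (e : (x * 1)%g = y) (e' : x = y) (r : R) m :
  cdot e m (@cd_id M 1%g r) = bcast M e' (m <*: r).
Proof. by rewrite /cdot cd_mu1r bcast_trans; apply: bcast_irr. Qed.

Lemma alpha_unique_cdot x y z u :
  (forall m n p, cdot erefl (cdot erefl m n) p =
     val u *: cdot (mulgA x y z) m (cdot erefl n p)) -> alpha x y z = u.
Proof. by move=> h; apply: alpha_unique => m n p; rewrite bcastZ; apply: h. Qed.

Lemma cd_id_surj g : g \in G -> forall m : M g, exists s, m = @cd_id M g s.
Proof.
by move=> hg m; have [_ [f fK Kf]] := cd_id_isom M hg; exists (f m); rewrite Kf.
Qed.

Lemma alpha_rel x y z : x \in G -> y \in G -> z \in G -> alpha x y z = 1%g.
Proof.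
move=> hx hy hz; apply: alpha_unique_cdot => m n p.
have [s ->] := cd_id_surj hx m; have [t ->] := cd_id_surj hy n.
have [v ->] := cd_id_surj hz p; rewrite UZ_val1 scale1r /cdot /=.
rewrite !cd_mu_mul// ?gpredM//.
suff E w (e : (x * (y * z))%g = w) (a : component S w) :
  val a = val s * (val t * val v) ->
  @cd_id M w a = bcast M e (@cd_id M _ (gmul s (gmul t v))).
  by apply: E; rewrite /= mulrA.
by case: _ / e a => a ha; congr cd_id; apply: val_inj; rewrite ha.
Qed.

Lemma alpha1l y z : alpha 1%g y z = 1%g.
Proof.
apply: alpha_unique_cdot => m n p; have [r ->] := cd_id_surj (gpred1 (s := G)) m.
rewrite UZ_val1 scale1r (cdot_id_l _ (esym (mul1g y))).
rewrite (cdot_castl _ (esym (congr1 (fun t => (t * z)%g) (mul1g y)))) cdotZl.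
rewrite (cdot_id_l _ (esym (congr1 (fun t => (t * z)%g) (mul1g y)))) bcastZ.
by congr (_ *: _); rewrite /cdot; apply: bcast_irr.
Qed.

Lemma alpha1m x z : alpha x 1%g z = 1%g.
Proof.
apply: alpha_unique_cdot => m n p; have [r ->] := cd_id_surj (gpred1 (s := G)) n.
rewrite UZ_val1 scale1r (cdot_id_r _ (esym (mulg1 x))).
rewrite (cdot_id_l _ (esym (mul1g z))).
rewrite (cdot_castl _ (esym (congr1 (fun t => (t * z)%g) (mulg1 x)))).
rewrite (cdot_castr _ (esym (congr1 (fun t => (t * z)%g) (mulg1 x)))).
by rewrite /cdot tpure_bal.
Qed.

Lemma alpha1r x y : alpha x y 1%g = 1%g.
Proof.
apply: alpha_unique_cdot => m n p; have [r ->] := cd_id_surj (gpred1 (s := G)) p.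
rewrite UZ_val1 scale1r (cdot_id_r _ (esym (mulg1 (x * y)%g))).
rewrite (cdot_id_r _ (esym (mulg1 y))).
rewrite (cdot_castr _ (esym (mulg1 (x * y)%g))) /cdot /=.
by have [[_ _ cr] _] := cd_mu_isom M x y; rewrite -cr tpure_ract.
Qed.

Definition alpha_cochain : cochain Gh R 3 := fun t =>
  alpha (tnth t (inord 0)) (tnth t (inord 1)) (tnth t (inord 2)).

Lemma alpha_cochainE x y z : alpha_cochain [tuple x; y; z] = alpha x y z.
Proof. by rewrite /alpha_cochain !(tnth_nth 1%g) !inordK. Qed.

Lemma alpha_pentagon x y z t :
  (alpha x y z * (alpha x (y * z) t * pic_act (phat x) (alpha y z t)) =
   alpha (x * y) z t * alpha x y (z * t))%g.
Proof.
apply: val_inj; apply: (scale_inj (cd_invertible (x * y * z * t)%g)).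
move=> l; have et : (x * (y * (z * t)) = x * y * z * t)%g by rewrite !mulgA.
pose J : tens (M x) (tens (M y) (tens (M z) (M t))) -> M (x * y * z * t)%g :=
  @bcast _ _ M _ _ et \o (@cd_mu M x (y * (z * t))%g \o
    tens_map id (@cd_mu M y (z * t)%g \o tens_map id (@cd_mu M z t))).
have IJ : bimod_isom J.
  apply: bimod_isom_comp (bcast_isom _); apply: bimod_isom_comp (cd_mu_isom _ _ _).
  apply: tens_map_isom (id_isom _) _; apply: bimod_isom_comp (cd_mu_isom _ _ _).
  by apply: tens_map_isom (id_isom _) _; apply: cd_mu_isom.
have [J' [_ _ JK]] := bimod_isom_inv IJ; rewrite -(JK l).
have [JD _ _] := IJ.1; have [muD _ _] := (cd_mu_isom M z t).1.
have hzt := (cd_mu_isom M z t).1; have hyzt := (cd_mu_isom M y (z * t)%g).1.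
have h1 := tens_map_hom (bimod_hom_id (M y)) hzt.
have h2 := bimod_hom_comp h1 hyzt.
move: (J' l); apply: (tens_ext3r (f := fun s => _ *: J s) (g := fun s => _ *: J s)).
- by move=> s s'; rewrite JD scalerDr.
- by move=> s s'; rewrite JD scalerDr.
move=> m n q; move: q.
apply: (tens_ext (f := fun q => _ *: J (m \ox (n \ox q)))
                 (g := fun q => _ *: J (m \ox (n \ox q)))).
- by move=> s s'; rewrite !tpureDr JD scalerDr.
- by move=> s s'; rewrite !tpureDr JD scalerDr.
move=> p q.
have -> : J (m \ox (n \ox (p \ox q))) =
    cdot et m (cdot erefl n (cdot erefl p q)).
  by rewrite /J /= tens_mapE//= tens_mapE.
have e1 : (x * y * (z * t) = x * y * z * t)%g by rewrite !mulgA.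
have e2 : (x * (y * z) * t = x * y * z * t)%g by rewrite !mulgA.
have e3 : (x * (y * z * t) = x * y * z * t)%g by rewrite !mulgA.
have E1 : cdot erefl (cdot erefl (cdot erefl m n) p) q =
  val (alpha (x * y)%g z t * alpha x y (z * t)%g)%g *:
  cdot et m (cdot erefl n (cdot erefl p q)).
  rewrite (cdotA erefl erefl erefl e1) (cdotA erefl e1 erefl et).
  by rewrite scalerA.
have E2 : cdot erefl (cdot erefl (cdot erefl m n) p) q =
  val (alpha x y z * (alpha x (y * z)%g t * pic_act (phat x) (alpha y z t)))%g *:
  cdot et m (cdot erefl n (cdot erefl p q)).
  rewrite (cdotA erefl erefl erefl (mulgA x y z)) cdotZl.
  rewrite (cdotA (mulgA x y z) erefl erefl e3).
  rewrite (cdotA erefl erefl erefl (mulgA y z t)) cdotZr.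
  rewrite -[cdot (mulgA y z t) _ _]/(bcast M (mulgA y z t) (cdot erefl n _)).
  by rewrite (cdot_castr _ et) !scalerA !UZ_valM mulrA.
by rewrite -E1 -E2.
Qed.

Lemma tuple3E (t : 3.-tuple Gh) : exists x y z, t = [tuple x; y; z].
Proof.
case: t => -[|x [|y [|z [|? ?]]]] // h; exists x, y, z.
exact: val_inj.
Qed.
Lemma tuple4E (t : 4.-tuple Gh) : exists x y z w, t = [tuple x; y; z; w].
Proof.
case: t => -[|x [|y [|z [|w [|? ?]]]]] // h; exists x, y, z, w.
exact: val_inj.
Qed.

Fact alpha_cocycle : @rel_cocycle Gh G R phat 3 alpha_cochain.
Proof.
apply/asboolP; split; first split=> t.
- have [x [y [z ->]]] := tuple3E t; rewrite alpha_cochainE !inE.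
  case/or3P => /eqP <-; [exact: alpha1l | exact: alpha1m | exact: alpha1r].
- have [x [y [z ->]]] := tuple3E t; rewrite alpha_cochainE => h.
  by apply: alpha_rel; apply: h; rewrite !inE eqxx ?orbT.
apply/funext => t; have [x [y [z [w ->]]]] := tuple4E t.
rewrite differential3E !alpha_cochainE.
have := alpha_pentagon x y z w.
set a := alpha x y z; set b := alpha x _ w; set c := pic_act _ _.
set d := alpha _ z w; set f := alpha x y _ => e.
rewrite [LHS]UZ_mulC -[(c * d^-1 * b * f^-1)%g]mulgA UZ_mulACA (UZ_mulC c b).
by rewrite mulgA e UZ_mulACA !mulgV mulg1.
Qed.

(* The characteristic class, computed from the choices M; it does not depend
   on them. *)
Definition kappa : relH G phat 3 :=
  relH_class (Sub alpha_cochain alpha_cocycle : relZ G phat 3).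
End CharacteristicClass.
Section Lifts.
Variables (Gh : groupType) (G : groupClosed Gh) (S : gradedRing G).
Local Notation R := (principal S).

(* The inclusion of S in the lift is an injective ring morphism [lift_in]. *)
Record lift := Lift {
  lift_ring :> gradedRing (@wholeGroup Gh);
  lift_strong : strongly_graded lift_ring;
  lift_in : {rmorphism S -> lift_ring};
  lift_inj : injective lift_in;
  lift_comp : forall g, g \in G -> forall a,
    a \in gcomp lift_ring g <-> exists2 s, s \in gcomp S g & lift_in s = a }.

Definition lift_base (L : lift) : {rmorphism R -> L} :=
  lift_in L \o (val : R -> S).

Fact lift_base_subproof (L : lift) r : lift_base L r \in gcomp L 1%g.
Proof.
apply: (proj2 (@lift_comp L 1%g (gpred1 (s := G)) _)).
by exists (val r); first exact: (valP r).
Qed.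

Definition lift_component (L : lift) (x : Gh) : bimodType R :=
  compBimod (lift_base_subproof L) x.

(* phat(x) = [L_x] for all x *)
Definition has_picard (L : lift) (phat : Gh -> pic R) : Prop :=
  forall x, phat x (lift_component L x).

Record picLift (phat : Gh -> pic R) := PicLift {
  pl_lift :> lift;
  pl_picard : has_picard pl_lift phat }.

(* Graded ring isomorphisms over S. *)
Definition lift_equiv (L L' : lift) : Prop :=
  exists f : {rmorphism L -> L'}, [/\ bijective f,
    forall x a, (f a \in gcomp L' x) = (a \in gcomp L x)
    & forall s, f (lift_in L s) = lift_in L' s].
End Lifts.

Section Twist.
Variables (Gh : groupType) (G : groupClosed Gh) (S : gradedRing G).
Local Notation R := (principal S).
Variables (phat : Gh -> pic R) (L : picLift phat) (c : relZ G phat 2).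

Definition tcoef x y : L := lift_base L (val (c [tuple x; y])).

Definition twist_mul (a b : L) : L :=
  gsum (fun x ax => gsum (fun y ay => tcoef x y * (ax * ay)) b) a.

Lemma twist_inner_add x y (ax : L) : {morph (fun ay => tcoef x y * (ax * ay)) : a b / a + b}.
Proof. by move=> a b; rewrite /= mulrDr mulrDr. Qed.

Lemma twist_mulDr : right_distributive twist_mul +%R.
Proof.
move=> a b b'; rewrite /twist_mul -gsumDf; apply: gsum_ext => x ax _.
by rewrite gsumD// => y; apply: twist_inner_add.
Qed.

Lemma twist_mulDl : left_distributive twist_mul +%R.
Proof.
move=> a a' b; rewrite /twist_mul gsumD// => x u v.
rewrite -gsumDf; apply: gsum_ext => y ay _; by rewrite mulrDl mulrDr.
Qed.

Lemma twist_mul_homog x y a b : a \in gcomp L x -> b \in gcomp L y ->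
  twist_mul a b = tcoef x y * (a * b).
Proof.
move=> ax bY; rewrite /twist_mul (gsum_homog _ ax); last first.
  by move=> h; rewrite /gsum big1// => y' _; rewrite mul0r mulr0.
by rewrite (gsum_homog _ bY)// => h; rewrite !mulr0.
Qed.

Lemma tcoef_in x y : tcoef x y \in gcomp L 1%g.
Proof. exact: lift_base_subproof. Qed.

Lemma twist_homog x y a b : a \in gcomp L x -> b \in gcomp L y ->
  twist_mul a b \in gcomp L (x * y)%g.
Proof.
move=> ax bY; rewrite (twist_mul_homog ax bY) -(mul1g (x * y)%g).
exact: gcompM (tcoef_in x y) (gcompM _ ax bY).
Qed.

Lemma lift_act x (a : L) (u : UZ R) : a \in gcomp L x ->
  a * lift_base L (val u) = lift_base L (val (pic_act (phat x) u)) * a.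
Proof.
move=> ax; pose m : lift_component L x := Sub a ax.
have := pic_actE u m (pl_picard L x).
by move/(congr1 val).
Qed.

Lemma tcoefM x y z :
  tcoef (x * y)%g z * tcoef x y =
  tcoef x (y * z)%g * lift_base L (val (pic_act (phat x) (c [tuple y; z]))).
Proof.
rewrite -!rmorphM; congr (lift_base L _).
have [_ /(congr1 (fun d => d [tuple x; y; z]))] := relZP c.
rewrite differential2E -![val c _]/(c _) => e.
have {}e : (c [tuple (x * y)%g; z] * c [tuple x; y] =
   c [tuple x; (y * z)%g] * pic_act (phat x) (c [tuple y; z]))%g.
  rewrite -(divg1_eq e) UZ_mulC -[X in (X * _)%g]mulgA -mulgA.
  by rewrite (UZ_mulC _ (c [tuple x; (y * z)%g])) mulgVK UZ_mulC.
exact: (congr1 val e).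
Qed.

Lemma twist_mul0r b : twist_mul 0 b = 0.
Proof. by apply: (addIr (twist_mul 0 b)); rewrite -twist_mulDl !add0r. Qed.
Lemma twist_mulr0 b : twist_mul b 0 = 0.
Proof. by apply: (addIr (twist_mul b 0)); rewrite -twist_mulDr !add0r. Qed.

Lemma twist_mulA : associative twist_mul.
Proof.
move=> a b d; elim/homog_ind: a => [|a a' h h'|x a ax].
- by rewrite !twist_mul0r.
- by rewrite !twist_mulDl h h'.
elim/homog_ind: b => [|b b' h h'|y b bY].
- by rewrite !(twist_mul0r, twist_mulr0).
- by rewrite !(twist_mulDl, twist_mulDr) h h'.
elim/homog_ind: d => [|d d' h h'|z d dz].
- by rewrite !twist_mulr0.
- by rewrite !twist_mulDr h h'.
have bd := twist_homog bY dz; have ab := twist_homog ax bY.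
rewrite (twist_mul_homog ax bd) (twist_mul_homog ab dz).
rewrite (twist_mul_homog ax bY) (twist_mul_homog bY dz).
rewrite [a * (_ * _)]mulrA (lift_act _ ax) !mulrA -tcoefM.
by [].
Qed.

Lemma tcoef1l y : tcoef 1%g y = 1.
Proof.
have [[h _] _] := relZP c.
by rewrite /tcoef [c _]h ?inE ?eqxx// UZ_val1 rmorph1.
Qed.
Lemma tcoef1r y : tcoef y 1%g = 1.
Proof.
have [[h _] _] := relZP c.
by rewrite /tcoef [c _]h ?inE ?eqxx ?orbT// UZ_val1 rmorph1.
Qed.
Lemma tcoefG g h : g \in G -> h \in G -> tcoef g h = 1.
Proof.
have [[_ r] _] := relZP c => hg hh.
rewrite /tcoef [c _]r ?UZ_val1 ?rmorph1// => k.
by rewrite !inE => /orP[]/eqP->.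
Qed.

Lemma twist_mul1 : left_id 1 twist_mul.
Proof.
elim/homog_ind => [|b b' h h'|y b bY]; first by rewrite twist_mulr0.
  by rewrite twist_mulDr h h'.
by rewrite (twist_mul_homog (gcomp1 L) bY) tcoef1l !mul1r.
Qed.
Lemma twist_mulr1 : right_id 1 twist_mul.
Proof.
elim/homog_ind => [|b b' h h'|y b bY]; first by rewrite twist_mul0r.
  by rewrite twist_mulDl h h'.
by rewrite (twist_mul_homog bY (gcomp1 L)) tcoef1r mul1r mulr1.
Qed.

Definition twist_car : Type := L.
HB.instance Definition _ := GRing.Zmodule.on twist_car.
HB.instance Definition _ := GRing.Zmodule_isPzRing.Build twist_car
  twist_mulA twist_mul1 twist_mulr1 twist_mulDl twist_mulDr.

Lemma twist_mulE (a b : twist_car) : a * b = twist_mul a b.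
Proof. by []. Qed.

Definition twist_comp (x : Gh) : zmodClosed twist_car := gcomp L x.

Definition twist_gr : gradedRing (@wholeGroup Gh) :=
  @GradedRing Gh (@wholeGroup Gh) twist_car twist_comp
    (@gcomp_out _ _ L) (@twist_homog) (@gr_sum _ _ L) (@gr_direct _ _ L).

Fact twist_strong : strongly_graded twist_gr.
Proof.
move=> h k hh hk a /(lift_strong (l := L) hh hk) [s [hs ->]].
pose u := lift_base L (val (c [tuple h; k])^-1%g).
have u1 : u \in gcomp L 1%g by apply: lift_base_subproof.
have ug p : p \in gcomp L h -> u * p \in gcomp L h.
  by move=> ph; have := gcompM _ u1 ph; rewrite mul1g.
exists [seq (u * p.1, p.2) | p <- s]; split.
  by move=> p /mapP[q /hs [q1 q2] ->]; split=> //; apply: ug.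
rewrite big_map big_seq [RHS]big_seq; apply: eq_bigr => p /hs [p1 p2] /=.
have cu : tcoef h k * u = 1.
  by rewrite /u /tcoef -rmorphM -UZ_valM mulgV UZ_val1 rmorph1.
rewrite [RHS](twist_mul_homog (ug _ p1) p2).
by rewrite -[u * p.1 * p.2]mulrA mulrA cu mul1r.
Qed.

Definition twist_in : S -> twist_gr := lift_in L.
Fact twist_in_zmod : GRing.zmod_morphism twist_in.
Proof. by move=> s t; apply: (rmorphB (lift_in L) s t). Qed.
Fact twist_in_monoid : GRing.monoid_morphism twist_in.
Proof.
have t0 : twist_in 0 = 0 by apply: (rmorph0 (lift_in L)).
have tD s t : twist_in (s + t) = twist_in s + twist_in t.
  exact: (rmorphD (lift_in L)).
split; first exact: (rmorph1 (lift_in L)).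
move=> s t; elim/homog_ind: s => [|s s' h h'|g s sg].
- by rewrite mul0r t0 mul0r.
- by rewrite mulrDl !tD mulrDl h h'.
elim/homog_ind: t => [|t t' h h'|k t tk].
- by rewrite mulr0 t0 mulr0.
- by rewrite mulrDr !tD mulrDr h h'.
have [hg|hg] := boolP (g \in G); last first.
  by rewrite (gcomp_out hg sg) mul0r t0 mul0r.
have [hk|hk] := boolP (k \in G); last first.
  by rewrite (gcomp_out hk tk) mulr0 t0 mulr0.
have s' : lift_in L s \in gcomp L g by apply: (proj2 (lift_comp (l := L) hg _)); exists s.
have t' : lift_in L t \in gcomp L k by apply: (proj2 (lift_comp (l := L) hk _)); exists t.
rewrite [RHS](twist_mul_homog s' t') tcoefG// mul1r.
exact: (rmorphM (lift_in L)).
Qed.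
HB.instance Definition _ := GRing.isZmodMorphism.Build S twist_gr twist_in twist_in_zmod.
HB.instance Definition _ := GRing.isMonoidMorphism.Build S twist_gr twist_in twist_in_monoid.

Definition twist_lift : lift S :=
  @Lift Gh G S twist_gr twist_strong twist_in (@lift_inj _ _ _ L) (@lift_comp _ _ _ L).

Fact twist_picard : has_picard twist_lift phat.
Proof.
move=> x; apply/(pic_iso _ (pl_picard L x)).
exists (fun m : lift_component L x => m : lift_component twist_lift x).
split; last by exists (fun m : lift_component twist_lift x => m).
split=> [m n|r m|m r]; apply: val_inj => //.
  rewrite /= [RHS](twist_mul_homog (lift_base_subproof L r) (valP m)).
  by rewrite tcoef1l mul1r.
rewrite /= [RHS](twist_mul_homog (valP m) (lift_base_subproof L r)).
by rewrite tcoef1r mul1r.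
Qed.

(* The lift obtained from L by twisting its multiplication by c:
   m_x m_y := c(x,y) m_x m_y on homogeneous elements. *)
Definition twist : picLift phat := PicLift twist_picard.
End Twist.

Section LiftClasses.
Variables (Gh : groupType) (G : groupClosed Gh) (S : gradedRing G).
Variable phat : Gh -> pic (principal S).
Implicit Types L : picLift phat.

Lemma lift_equiv_refl (L : lift S) : lift_equiv L L.
Proof. by exists idfun; split=> //; exists id. Qed.

Lemma lift_equiv_trans (L1 L2 L3 : lift S) :
  lift_equiv L1 L2 -> lift_equiv L2 L3 -> lift_equiv L1 L3.
Proof.
move=> [f [bf fh fi]] [g [bg gh gi]]; exists (g \o f); split.
- exact: bij_comp.
- by move=> x a; rewrite /= gh fh.
- by move=> s; rewrite /= fi gi.
Qed.

Lemma lift_equiv_sym (L1 L2 : lift S) : lift_equiv L1 L2 -> lift_equiv L2 L1.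
Proof.
move=> [f [[g fK gK] fh fi]].
have gB : GRing.zmod_morphism g by apply: can2_zmod_morphism fK gK.
have gM : GRing.monoid_morphism g by apply: can2_monoid_morphism fK gK.
pose gZ := GRing.isZmodMorphism.Build L2 L1 g gB.
pose gO := GRing.isMonoidMorphism.Build L2 L1 g gM.
pose gr : {rmorphism L2 -> L1} := HB.pack g gZ gO.
exists gr; split; first by exists f.
- by move=> x a; rewrite -fh /= gK.
- by move=> s; rewrite /= -fi fK.
Qed.

(* An equivalence class, as a predicate on lifts (in a large universe, like
   pic). *)
Record liftClass := LiftClass {
  lc_mem :> picLift phat -> Prop;
  lc_memP : exists L, lc_mem = fun L' => lift_equiv L L' }.

Definition lift_class L : liftClass :=
  @LiftClass (fun L' => lift_equiv L L') (ex_intro _ L erefl).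

Lemma liftClass_ext (l l' : liftClass) : lc_mem l = lc_mem l' -> l = l'.
Proof.
case: l l' => [P hP] [Q hQ] /= e.
by case: _ / e hQ => hQ; congr LiftClass; apply: Prop_irrelevance.
Qed.

Lemma lift_classP L L' : lift_class L = lift_class L' <-> lift_equiv L L'.
Proof.
split=> [[/(congr1 (fun P => P L')) e]|e].
  by rewrite e; apply: lift_equiv_refl.
apply: liftClass_ext; apply/funext => L2; apply/propext; split=> h.
  exact: lift_equiv_trans (lift_equiv_sym e) h.
exact: lift_equiv_trans e h.
Qed.

Lemma lift_class_surj (l : liftClass) : exists L, l = lift_class L.
Proof.
by have [L e] := lc_memP l; exists L; apply: liftClass_ext.
Qed.
End LiftClasses.

Definition is_left_action (K : groupType) (X : Type) (act : K -> X -> X) : Prop :=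
  (forall x, act 1%g x = x) /\
  (forall k l x, act (k * l)%g x = act k (act l x)).

(* A simply transitive action is in particular on a nonempty set. *)
Definition simply_transitive (K : groupType) (X : Type) (act : K -> X -> X) : Prop :=
  inhabited X /\ forall x y, exists! k, act k x = y.

(* Main.v *)
Require Import Defs.
From HB Require Import structures.
From mathcomp Require Import all_boot all_algebra.
From mathcomp Require Import boolp classical_sets.

Set Implicit Arguments.
Unset Strict Implicit.
Unset Printing Implicit Defensive.
Import GRing.Theory.
Local Open Scope ring_scope.

(** Why the theorem holds.  Call two lifts L and L' c-related, for a relative
    2-cocycle c, if there is an additive graded bijection phi : L -> L' that is
    the identity on S and satisfies phi(a) phi(b) = c(x,y) phi(ab) for a of
    degree x and b of degree y ([twisted] below).  Being 1-related means being
    equivalent, the identity map c-relates L to its twist by c, and composing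
    or inverting the maps phi multiplies or inverts the cocycles.  Hence
    the class of c sends the class of L to the class of L' exactly when L and
    L' are c-related, and the theorem reduces to three facts.

    - Stabilizers are trivial: L is c-related to itself if and only if c is a
      relative coboundary ([twisted_coboundary], [coboundary_twisted]).
      A map phi as above restricts on each component L_x to an automorphism of
      an invertible bimodule, which is multiplication by a central unit b(x),
      and the condition on phi says that c is the coboundary of b.
    - Transitivity: any two lifts L, L' with Picard homomorphism phat are
      c-related for some c ([picLift_twisted]).  Choose isomorphisms
      L_x -> L'_x, equal to the identity of S_g for g in G.  As multiplication
      L_x (x) L_y -> L_xy is an isomorphism in a strongly graded ring
      ([tens_comp_mul_isom]), the two ways to go from L_x (x) L_y to L'_xy
      differ by a central unit c(x,y), and the associativity of the two
      products makes c a cocycle.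
    - Existence: if kappa vanishes, the obstruction alpha to the associativity
      of the maps mu_(x,y) is the coboundary of a relative 2-cochain b, so the
      maps b(x,y) mu_(x,y) are associative and turn the direct sum of the
      bimodules M_x into a lift ([cross_picLift]). *)

(** * Central units acting on a lift *)

Section LiftTheory.
Variables (Gh : groupType) (G : groupClosed Gh) (S : gradedRing G).
Local Notation R := (principal S).
Variable phat : Gh -> pic R.
Implicit Types (L : picLift phat) (x y z : Gh) (u v : UZ R).

Lemma UZ_mulVCK (u v w : UZ R) : (u * v^-1 * w * v = w * u)%g.
Proof. by rewrite -[(u * _ * w)%g]mulgA (UZ_mulC v^-1%g) mulgA mulgVK UZ_mulC. Qed.

Definition coef L u : L := lift_base L (val u).

Lemma coefM L u v : coef L (u * v)%g = coef L u * coef L v.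
Proof. by rewrite /coef UZ_valM rmorphM. Qed.

Lemma coef1 L : coef L 1%g = 1.
Proof. by rewrite /coef UZ_val1 rmorph1. Qed.

Lemma coefVK L u (a : L) : coef L u^-1%g * (coef L u * a) = a.
Proof. by rewrite mulrA -coefM mulVg coef1 mul1r. Qed.

Lemma coef_in L u x a : a \in gcomp L x -> coef L u * a \in gcomp L x.
Proof.
by move=> ax; have := gcompM _ (lift_base_subproof L (val u)) ax; rewrite mul1g.
Qed.

Lemma coef_comm L x (a : L) u : a \in gcomp L x ->
  a * coef L u = coef L (pic_act (phat x) u) * a.
Proof. exact: lift_act. Qed.

(** An invertible bimodule is faithful, so a central unit is determined by its
    action on a single component of a lift. *)
Lemma coef_inj L x u v :
  (forall a, a \in gcomp L x -> coef L u * a = coef L v * a) -> u = v.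
Proof.
move=> e; apply: val_inj; apply: (scale_inj (pic_invertible (pl_picard L x))).
by move=> m; apply: val_inj; apply: e; apply: (valP m).
Qed.

(** By strong grading, products of homogeneous elements span the component of
    degree xy, and so suffice to compare two central units. *)
Lemma coef_injM L x y u v : (forall a b, a \in gcomp L x -> b \in gcomp L y ->
    coef L u * (a * b) = coef L v * (a * b)) -> u = v.
Proof.
move=> e; apply: (@coef_inj L (x * y)%g) => a.
move=> /(lift_strong (l := L) (h := x) (k := y) isT isT) [s [hs ->]].
rewrite !mulr_sumr big_seq [RHS]big_seq.
by apply: eq_bigr => p /hs[]; apply: e.
Qed.

Lemma coef_injM3 L x y z u v :
  (forall a b d, a \in gcomp L x -> b \in gcomp L y -> d \in gcomp L z ->
    coef L u * (a * b * d) = coef L v * (a * b * d)) -> u = v.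
Proof.
move=> e; apply: (@coef_injM L (x * y)%g z) => a d.
move=> /(lift_strong (l := L) (h := x) (k := y) isT isT) [s [hs ->]] dz.
rewrite mulr_suml !mulr_sumr big_seq [RHS]big_seq.
by apply: eq_bigr => p /hs[p1 p2]; apply: e.
Qed.

Lemma lift_in_homog L g s : s \in gcomp S g -> lift_in L s \in gcomp L g.
Proof.
move=> sg; have [hg|hg] := boolP (g \in G).
  by apply/(lift_comp (l := L) hg); exists s.
by rewrite (gcomp_out hg sg) rmorph0 rpred0.
Qed.

Lemma lift_principal L a : a \in gcomp L 1%g -> exists r : R, a = lift_base L r.
Proof.
move=> /(lift_comp (l := L) (gpred1 (s := G))) [s s1 <-].
by exists (Sub s s1).
Qed.

(** * Lifts related by a cocycle *)

(** The relation between a lift and a copy of its twist by c.  Stating it with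
    a bijection from L itself, and not from the twist, lets cocycles be composed
    without iterating the twisting construction. *)
Definition twisted (c : relZ G phat 2) L L' : Prop :=
  exists phi : L -> L', [/\ bijective phi, {morph phi : a b / a + b},
    forall x a, (phi a \in gcomp L' x) = (a \in gcomp L x),
    forall s, phi (lift_in L s) = lift_in L' s
  & forall x y a b, a \in gcomp L x -> b \in gcomp L y ->
      phi a * phi b = coef L' (c [tuple x; y]) * phi (a * b)].

Lemma relZ_1l (c : relZ G phat 2) x : c [tuple 1%g; x] = 1%g.
Proof. by have [[h _] _] := relZP c; apply: h; rewrite !inE eqxx. Qed.

Lemma relZ_1r (c : relZ G phat 2) x : c [tuple x; 1%g] = 1%g.
Proof. by have [[h _] _] := relZP c; apply: h; rewrite !inE eqxx orbT. Qed.

(** A central unit is an element of S of degree 1, where c is normalized, hence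
    it commutes with phi. *)
Lemma twisted_coef (c : relZ G phat 2) L L' (phi : L -> L') x a u :
  (forall s, phi (lift_in L s) = lift_in L' s) ->
  (forall x y a b, a \in gcomp L x -> b \in gcomp L y ->
      phi a * phi b = coef L' (c [tuple x; y]) * phi (a * b)) ->
  a \in gcomp L x -> phi (coef L u * a) = coef L' u * phi a.
Proof.
move=> phiS phiM ax; have := phiM _ _ _ _ (lift_base_subproof L (val u)) ax.
by rewrite relZ_1l coef1 mul1r phiS => <-.
Qed.

Lemma twisted_one L L' : lift_equiv L L' <-> twisted 1%g L L'.
Proof.
split=> [[f [fb fg fS]]|[f [fb fD fg fS fM]]].
  exists f; split=> // [a b|x y a b _ _]; first exact: rmorphD.
  by rewrite [RHS](_ : _ = 1 * f (a * b)) ?coef1// mul1r rmorphM.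
have f1 : f 1 = 1 by rewrite -(rmorph1 (lift_in L)) fS rmorph1.
have f0 : f 0 = 0 by apply: (addIr (f 0)); rewrite -fD !add0r.
have fB : GRing.zmod_morphism f.
  move=> a b; apply/eqP; rewrite eq_sym subr_eq -fD subrK; exact/eqP.
have fMM : GRing.monoid_morphism f.
  split=> // a b; elim/homog_ind: a => [|a a' h h'|x a ax].
  - by rewrite mul0r f0 mul0r.
  - by rewrite mulrDl !fD h h' mulrDl.
  elim/homog_ind: b => [|b b' h h'|y b bY].
  - by rewrite mulr0 f0 mulr0.
  - by rewrite mulrDr !fD h h' mulrDr.
  by rewrite (fM x y)// coef1 mul1r.
pose fZ := GRing.isZmodMorphism.Build L L' f fB.
pose fO := GRing.isMonoidMorphism.Build L L' f fMM.
pose fr : {rmorphism L -> L'} := HB.pack f fZ fO.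
by exists fr.
Qed.

Lemma relZ_mulE (c c' : relZ G phat 2) t :
  ((c * c')%g : relZ G phat 2) t = (c t * c' t)%g.
Proof. by []. Qed.

Lemma relZ_invE (c : relZ G phat 2) t : ((c^-1)%g : relZ G phat 2) t = (c t)^-1%g.
Proof. by []. Qed.

Lemma twisted_comp c c' L1 L2 L3 :
  twisted c L1 L2 -> twisted c' L2 L3 -> twisted (c * c')%g L1 L3.
Proof.
move=> [f [fb fD fg fS fM]] [h [hb hD hg hS hM]]; exists (h \o f); split.
- exact: bij_comp.
- by move=> a b; rewrite /= fD hD.
- by move=> x a; rewrite /= hg fg.
- by move=> s; rewrite /= fS hS.
move=> x y a b ax bY; have ab := gcompM _ ax bY.
rewrite /= (hM x y) ?fg// (fM x y)// (twisted_coef _ hS hM (x := (x * y)%g)) ?fg//.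
by rewrite relZ_mulE UZ_mulC coefM mulrA.
Qed.

Lemma twisted_inv c L L' : twisted c L L' -> twisted (c^-1)%g L' L.
Proof.
move=> [f [[h fK hK] fD fg fS fM]]; exists h; split.
- by exists f.
- by move=> a b; apply: (can_inj fK); rewrite fD !hK.
- by move=> x a; rewrite -fg hK.
- by move=> s; rewrite -fS fK.
move=> x y a b; rewrite -{1}(hK a) -{1}(hK b) !fg => ax bY.
have ab := gcompM _ ax bY.
apply: (can_inj fK); rewrite (twisted_coef _ fS fM (x := (x * y)%g)); last first.
  by rewrite -fg hK -{1}(hK a) -{1}(hK b) (fM x y)// coef_in// fg.
by rewrite hK -{2}(hK a) -{2}(hK b) (fM x y)// relZ_invE coefVK.
Qed.

Lemma twisted_twist c L : twisted c L (twist L c).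
Proof.
exists id; split=> //; first by exists id.
move=> x y a b ax bY.
have ab := gcompM _ ax bY.
rewrite [LHS](twist_mul_homog c ax bY).
by rewrite [RHS](twist_mul_homog c (lift_base_subproof L _) ab) tcoef1l mul1r.
Qed.

(** * Gluing isomorphisms of components *)

Definition hpart L x (a : L) : lift_component L x :=
  Sub (proj a x) (proj_in a x).

Lemma hpart_homog L x (m : lift_component L x) : hpart x (val m) = m.
Proof. by apply: val_inj; rewrite /= (proj_homog _ (valP m)) eqxx. Qed.

Lemma hpart0 L x : hpart x (0 : L) = 0.
Proof. by apply: val_inj; apply: proj0. Qed.

Definition comp_maps L L' := forall x, lift_component L x -> lift_component L' x.

Definition glue L L' (psi : comp_maps L L') (a : L) : L' :=
  gsum (fun x b => val (psi x (hpart x b))) a.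

Lemma glueD L L' (psi : comp_maps L L') :
  (forall x, bimod_hom (psi x)) -> {morph glue psi : a b / a + b}.
Proof.
move=> hpsi a b; apply: gsumD => x u v; have [psiD _ _] := hpsi x.
by rewrite -raddfD -psiD; congr (val (psi x _)); apply: val_inj; apply: projD.
Qed.

Lemma glue_homog L L' (psi : comp_maps L L')
    x (m : lift_component L x) : (forall x, bimod_hom (psi x)) ->
  glue psi (val m) = val (psi x m).
Proof.
move=> hpsi; rewrite /glue (gsum_homog _ (valP m)) ?hpart_homog// => z.
by rewrite hpart0 bimod_hom0.
Qed.

Lemma glue0 L L' (psi : comp_maps L L') :
  (forall x, bimod_hom (psi x)) -> glue psi 0 = 0.
Proof. by move=> h; apply: (addIr (glue psi 0)); rewrite -glueD// !add0r. Qed.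

Lemma glue_can L L' (psi : comp_maps L L')
    (psi' : comp_maps L' L) :
  (forall x, bimod_hom (psi x)) -> (forall x, bimod_hom (psi' x)) ->
  (forall x, cancel (psi x) (psi' x)) -> cancel (glue psi) (glue psi').
Proof.
move=> h h' K; elim/homog_ind => [|a b ha hb|x a ax].
- by rewrite !glue0.
- by rewrite !glueD// ha hb.
rewrite -[a]/(val (Sub a ax : lift_component L x)).
by rewrite !glue_homog// K.
Qed.

Lemma lift_in_comp L g (s : component S g) : gcomp_pred g (lift_in L (val s)).
Proof. by apply: lift_in_homog; apply: (valP s). Qed.

Definition comp_in L g (s : component S g) : lift_component L g :=
  Sub (lift_in L (val s)) (lift_in_comp L s).

(** Up to the behaviour on products, which is where a cocycle enters, the maps
    relating two lifts are the same thing as families of isomorphisms of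
    their components that respect the copies of S_g. *)
Lemma glueP L L' (psi : comp_maps L L') :
  (forall x, bimod_isom (psi x)) ->
  (forall g, g \in G -> forall s : component S g,
     psi g (comp_in L s) = comp_in L' s) ->
  [/\ bijective (glue psi), {morph glue psi : a b / a + b},
    forall x a, (glue psi a \in gcomp L' x) = (a \in gcomp L x)
  & forall s, glue psi (lift_in L s) = lift_in L' s].
Proof.
move=> hpsi psiS; have hh x := (hpsi x).1.
have [psi' hpsi'] : exists psi' : comp_maps L' L,
    forall x, [/\ bimod_isom (psi' x), cancel (psi x) (psi' x) & cancel (psi' x) (psi x)].
  have hi x := cid (bimod_isom_inv (hpsi x)).
  by exists (fun x => projT1 (hi x)) => x; apply: (projT2 (hi x)).
have hh' x : bimod_hom (psi' x) by case: (hpsi' x) => -[].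
have K : cancel (glue psi) (glue psi') by apply: glue_can => // x; case: (hpsi' x).
have K' : cancel (glue psi') (glue psi) by apply: glue_can => // x; case: (hpsi' x).
split.
- by exists (glue psi').
- exact: glueD.
- move=> x a; apply/idP/idP => ax.
    rewrite -(K a) -[glue psi a]/(val (Sub (glue psi a) ax : lift_component L' x)).
    by rewrite glue_homog//; apply: (valP (psi' x _)).
  rewrite -[a]/(val (Sub a ax : lift_component L x)) glue_homog//.
  exact: (valP (psi x _)).
elim/homog_ind => [|s t hs ht|g s sg].
- by rewrite !rmorph0 glue0.
- by rewrite !rmorphD glueD// hs ht.
have [hg|hg] := boolP (g \in G); last first.
  by rewrite (gcomp_out hg sg) !rmorph0 glue0.
pose s' : component S g := Sub s sg.
rewrite -[lift_in L s]/(val (comp_in L s')) glue_homog//.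
by rewrite psiS.
Qed.

(** * Stabilizers *)

(** If c is the coboundary of b, multiply by b(x) in degree x: moving b(y) to
    the left past an element of degree x applies the action of x, and
    b(x) (x.b(y)) = c(x,y) b(xy). *)
Lemma coboundary_twisted (c : relZ G phat 2) L :
  rel_coboundary G phat (val c) -> twisted c L L.
Proof.
move=> [b [b1 bG] cb].
pose psi x (m : lift_component L x) : lift_component L x := val (b [tuple x]) *: m.
have psih x : bimod_isom (psi x).
  split; last first.
    exists (fun m => val (b [tuple x])^-1%g *: m) => m; rewrite /psi scalerA -UZ_valM.
      by rewrite mulVg scale1r.
    by rewrite mulgV scale1r.
  split=> [m n|r m|m r]; rewrite /psi ?scalerDr ?ractZ//.
  by rewrite !scalerA UZ_central.
have [|pb pD pg pS] := glueP psih.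
  move=> g hg s; rewrite /psi bG ?UZ_val1 ?scale1r// => k.
  by rewrite !inE => /eqP->.
exists (glue psi); split=> // x y a d ax dy.
have E z e (ez : e \in gcomp L z) : glue psi e = coef L (b [tuple z]) * e.
  rewrite -[in LHS](_ : val (Sub e ez : lift_component L z) = e)//.
  by rewrite glue_homog// => t; have [] := psih t.
rewrite (E x)// (E y)// (E (x * y)%g) ?gcompM//.
rewrite mulrA -[_ * a * _]mulrA (coef_comm _ ax) !mulrA -!coefM -!mulrA.
congr (coef L _ * _).
by rewrite -[c _]/(val c _) cb differential1E UZ_mulVCK.
Qed.

(** Conversely, an automorphism of the invertible bimodule L_x is multiplication
    by a central unit b(x), and b(g) = 1 for g in G as S is fixed. *)
Lemma twisted_coboundary (c : relZ G phat 2) L :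
  twisted c L L -> rel_coboundary G phat (val c).
Proof.
move=> [f [fb fD fg fS fM]].
have fx x (m : lift_component L x) : gcomp_pred x (f (val m)).
  by rewrite /gcomp_pred fg; apply: (valP m).
pose h x (m : lift_component L x) : lift_component L x := Sub (f (val m)) (fx x m).
have hh x : bimod_isom (@h x).
  split.
    split=> [m n|r m|m r]; apply: val_inj; rewrite /= ?fD//.
      have := fM _ _ _ _ (lift_base_subproof L r) (valP m).
      by rewrite relZ_1l coef1 mul1r fS => <-.
    have := fM _ _ _ _ (valP m) (lift_base_subproof L r).
    by rewrite relZ_1r coef1 mul1r fS => <-.
  have [f' fK fK'] := fb.
  have fx' (m : lift_component L x) : gcomp_pred x (f' (val m)).
    by rewrite /gcomp_pred -fg fK'; apply: (valP m).
  by exists (fun m => Sub (f' (val m)) (fx' m)) => m; apply: val_inj; rewrite /= ?fK ?fK'.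
have hu x : exists u, forall a, a \in gcomp L x -> f a = coef L u * a.
  have [u eu] := auto_UZ (pic_invertible (pl_picard L x)) (hh x).
  by exists u => a ax; apply: (congr1 val (eu (Sub a ax))).
have [b hb] := choice hu.
have b1 g : g \in G -> b g = 1%g.
  move=> hg; apply: (@coef_inj L g) => a ag; rewrite -hb// coef1 mul1r.
  by move: ag => /(lift_comp (l := L) hg) [s _ <-].
exists (fun t : 1.-tuple Gh => b (thead t)).
  split=> -[[|z [|? ?]] // i] ht; apply: (b1 z); last by apply: ht; rewrite inE.
  by move: ht; rewrite inE => /eqP <-; apply: gpred1.
apply/funext => t; rewrite -[val c t]/(c t).
have [x [y ->]] : exists x y, t = [tuple x; y].
  by case: t => -[|x [|y [|? ?]]] // i; exists x, y; apply: val_inj.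
rewrite differential1E /thead !(tnth_nth 1%g) /=.
apply: (mulIg (b (x * y)%g)); rewrite UZ_mulVCK.
apply: (@coef_injM L x y) => a d ax dy.
have ad := gcompM _ ax dy.
rewrite !coefM -[LHS]mulrA -(hb _ _ ad) -(fM x y)// (hb x)// (hb y)//.
by rewrite mulrA -[_ * a * _]mulrA (coef_comm _ ax) !mulrA.
Qed.

(** * Transitivity *)

Definition comp_mul L x y (a : lift_component L x) (b : lift_component L y) :
  lift_component L (x * y)%g := gmul a b.

Lemma comp_mul_bal L x y : balanced (@comp_mul L x y).
Proof.
split=> [b a a'|a b b'|a r b]; apply: val_inj; rewrite /= ?mulrDl ?mulrDr//.
by rewrite mulrA.
Qed.

Definition tens_comp_mul L x y :
    tens (lift_component L x) (lift_component L y) -> lift_component L (x * y)%g :=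
  tens_lift (@comp_mul L x y).

Lemma tens_comp_mulE L x y (a : lift_component L x) (b : lift_component L y) :
  val (tens_comp_mul (a \ox b)) = val a * val b.
Proof. by rewrite /tens_comp_mul (tens_liftE (@comp_mul_bal L x y)). Qed.

Lemma tens_comp_mul_hom L x y : bimod_hom (@tens_comp_mul L x y).
Proof.
apply: tens_lift_hom; first exact: comp_mul_bal.
  by move=> r a b; apply: val_inj; rewrite /= mulrA.
by move=> a b r; apply: val_inj; rewrite /= mulrA.
Qed.

(** Write 1 as a finite sum of products p.1 * p.2 with p.1 of degree y^-1 and
    p.2 of degree y.  The inverse of the multiplication sends m to the sum of
    the m p.1 (x) p.2: when m = ab, the factor b p.1 lies in R and moves across
    the tensor sign, which gives back a (x) b. *)
Lemma tens_comp_mul_isom L x y : bimod_isom (@tens_comp_mul L x y).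
Proof.
have hm := @tens_comp_mul_hom L x y; split=> //.
have h1 : 1 \in gcomp L (y^-1 * y)%g by rewrite mulVg gcomp1.
have [s [hs e1]] := lift_strong (l := L) (h := y^-1%g) (k := y) isT isT h1.
(* The projection makes the inverse a function of arbitrary pairs p; it does
   nothing to the pairs in s. *)
have inx (m : lift_component L (x * y)%g) (p : L * L) :
    gcomp_pred x (val m * proj p.1 y^-1%g).
  by have := gcompM _ (valP m) (proj_in p.1 y^-1%g); rewrite mulgK.
pose F (m : lift_component L (x * y)%g) (p : L * L) :=
  (Sub (val m * proj p.1 y^-1%g) (inx m p) : lift_component L x)
    \ox (hpart y p.2 : lift_component L y).
have FD p : {morph F^~ p : m n / m + n}.
  move=> m n; rewrite /F -tpureDl; congr (_ \ox _).
  by apply: val_inj; rewrite /= mulrDl.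
have pE z w p : p \in gcomp L z -> z = w -> proj p w = p.
  by move=> pz <-; rewrite (proj_homog _ pz) eqxx.
exists (fun m => \sum_(p <- s) F m p); last first.
  move=> m; rewrite (bimod_hom_sum _ _ hm); apply: val_inj.
  rewrite raddf_sum -[RHS]mulr1 e1 mulr_sumr big_seq [RHS]big_seq.
  apply: eq_bigr => p /hs[p1 p2].
  by rewrite [LHS]tens_comp_mulE /= (pE _ _ _ p1)// (pE _ _ _ p2)// mulrA.
have [mD _ _] := hm.
apply: (tens_ext (f := fun t => \sum_(p <- s) F (tens_comp_mul t) p) (g := id)) => //.
  by move=> t u; rewrite -big_split; apply: eq_bigr => p _; rewrite mD FD.
move=> a b.
have Fp p : p \in s -> exists n : lift_component L y,
    F (tens_comp_mul (a \ox b)) p = a \ox n /\ val n = val b * p.1 * p.2.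
  move=> /hs[p1 p2].
  have : val b * p.1 \in gcomp L 1%g by rewrite -(mulgV y) gcompM//; apply: (valP b).
  move=> /lift_principal[r er]; exists (r *: hpart y p.2); split; last first.
    by rewrite er /= (pE _ _ _ p2).
  rewrite -tpure_bal /F; congr (_ \ox _); apply: val_inj.
  by rewrite /= tens_comp_mulE (pE _ _ _ p1)// -mulrA er.
have [n hn] : exists n : L * L -> lift_component L y, forall p, p \in s ->
    F (tens_comp_mul (a \ox b)) p = a \ox n p /\ val (n p) = val b * p.1 * p.2.
  have c p : exists n : lift_component L y, p \in s ->
    F (tens_comp_mul (a \ox b)) p = a \ox n /\ val n = val b * p.1 * p.2.
    have [ps|ps] := boolP (p \in s); last by exists 0.
    by have [n hn] := Fp p ps; exists n.
  by have [n hn] := choice c; exists n.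
rewrite big_seq (eq_bigr (fun p => a \ox n p)); last by move=> p /hn[].
have a0 : a \ox (0 : lift_component L y) = 0.
  by apply: (addIr (a \ox 0)); rewrite -tpureDr !add0r.
rewrite -big_seq -(big_morph _ (tpureDr a) a0).
congr (_ \ox _); apply: val_inj; rewrite raddf_sum /= -[RHS]mulr1 e1 mulr_sumr.
rewrite big_seq [RHS]big_seq; apply: eq_bigr => p /hn[_ ->].
by rewrite mulrA.
Qed.

(** Both sides, as functions of a (x) b, are isomorphisms from L_x (x) L_y onto
    the invertible bimodule L'_xy, so they differ by an automorphism of it. *)
Lemma comp_maps_unit L L' (psi : comp_maps L L') x y :
  (forall x, bimod_isom (psi x)) -> exists u, forall a b,
    val (psi x a) * val (psi y b) = coef L' u * val (psi (x * y)%g (comp_mul a b)).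
Proof.
move=> hpsi.
have [M [IM MK KM]] := bimod_isom_inv
  (bimod_isom_comp (@tens_comp_mul_isom L x y) (hpsi (x * y)%g)).
have I2 := bimod_isom_comp IM (bimod_isom_comp (tens_map_isom (hpsi x) (hpsi y))
  (@tens_comp_mul_isom L' x y)).
have [u hu] := auto_UZ (pic_invertible (pl_picard L' (x * y)%g)) I2.
exists u => a b; rewrite -tens_comp_mulE.
have -> : psi x a \ox psi y b = tens_map (psi x) (psi y) (a \ox b).
  by rewrite tens_mapE//; [case: (hpsi x)|case: (hpsi y)].
have := hu (psi (x * y)%g (tens_comp_mul (a \ox b))).
rewrite [in LHS]/= -[M _]/(M ((psi _ \o @tens_comp_mul L x y) (a \ox b))) MK => ->.
by congr (_ * val (psi _ _)); rewrite /tens_comp_mul (tens_liftE (@comp_mul_bal L x y)).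
Qed.

Lemma comp_in_isom L g : g \in G -> bimod_isom (@comp_in L g).
Proof.
move=> hg; split.
  split=> [s t|r s|s r]; apply: val_inj; rewrite /= ?raddfD//.
    by rewrite rmorphM.
  by rewrite rmorphM.
have sur (m : lift_component L g) : exists s, comp_in L s = m.
  have /(lift_comp (l := L) hg)[s sg e] := valP m.
  by exists (Sub s sg); apply: val_inj.
have [h hK] := choice sur; exists h => // s.
apply: val_inj; have /(congr1 val) := hK (comp_in L s).
exact: Defs.lift_inj.
Qed.

(** For x in G the isomorphism L_x -> L'_x has to be the one through S_x, and
    any isomorphism will do for the other x.  The cocycle c measures the failure
    of the glued map f to be multiplicative; its cocycle identity is obtained by
    expanding f(a) f(b) f(d) in two ways. *)
Lemma picLift_twisted L L' : exists c, twisted c L L'.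
Proof.
have psiE x : exists psi : lift_component L x -> lift_component L' x,
    bimod_isom psi /\ (x \in G -> forall s, psi (comp_in L s) = comp_in L' s).
  have [xG|xG] := boolP (x \in G); last first.
    have /(pic_iso _ (pl_picard L x))[psi hpsi] := pl_picard L' x.
    by exists psi.
  have [h [hI hK _]] := bimod_isom_inv (comp_in_isom L xG).
  exists (@comp_in L' x \o h); split; last by move=> _ s; rewrite /= hK.
  exact: bimod_isom_comp hI (comp_in_isom L' xG).
pose psi x := projT1 (cid (psiE x)).
have hpsi x : bimod_isom (psi x) by case: (projT2 (cid (psiE x))).
have psiG x : x \in G -> forall s, psi x (comp_in L s) = comp_in L' s.
  by case: (projT2 (cid (psiE x))).
have [fb fD fg fS] := glueP hpsi psiG; set f := glue psi in fb fD fg fS.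
have [c hc] : exists c : Gh -> Gh -> UZ R, forall x y a b,
    a \in gcomp L x -> b \in gcomp L y -> f a * f b = coef L' (c x y) * f (a * b).
  have cE p : exists u, forall a b, a \in gcomp L p.1 -> b \in gcomp L p.2 ->
      f a * f b = coef L' u * f (a * b).
    have [u hu] := comp_maps_unit p.1 p.2 hpsi.
    exists u => a b ax bY.
    pose a' : lift_component L p.1 := Sub a ax.
    pose b' : lift_component L p.2 := Sub b bY.
    have hh x := (hpsi x).1.
    rewrite -[a]/(val a') -[b]/(val b') -[val a' * _]/(val (comp_mul a' b')).
    by rewrite /f !glue_homog.
  by have [u hu] := choice cE; exists (fun x y => u (x, y)) => x y; apply: (hu (x, y)).
have c1l x : c 1%g x = 1%g.
  apply: (@coef_inj L' x) => a' ax; rewrite coef1 mul1r.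
  have [h fK hK] := fb; rewrite -(hK a') in ax *; rewrite fg in ax.
  have := hc _ _ _ _ (gcomp1 L) ax; rewrite mul1r => <-.
  by rewrite -(rmorph1 (lift_in L)) fS rmorph1 mul1r.
have c1r x : c x 1%g = 1%g.
  apply: (@coef_inj L' x) => a' ax; rewrite coef1 mul1r.
  have [h fK hK] := fb; rewrite -(hK a') in ax *; rewrite fg in ax.
  have := hc _ _ _ _ ax (gcomp1 L); rewrite mulr1 => <-.
  by rewrite -(rmorph1 (lift_in L)) fS rmorph1 mulr1.
have cG x y : x \in G -> y \in G -> c x y = 1%g.
  move=> xG yG; apply: (@coef_injM L' x y) => a b.
  move=> /(lift_comp (l := L') xG)[s sx <-] /(lift_comp (l := L') yG)[t ty <-].
  have := hc _ _ _ _ (lift_in_homog L sx) (lift_in_homog L ty).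
  by rewrite -rmorphM !fS coef1 mul1r -rmorphM => <-.
have cL x a u : a \in gcomp L x -> f (coef L u * a) = coef L' u * f a.
  move=> ax; have := hc _ _ _ _ (lift_base_subproof L (val u)) ax.
  by rewrite c1l coef1 mul1r fS => <-.
have cA x y z : (pic_act (phat x) (c y z) * c x (y * z) = c (x * y) z * c x y)%g.
  apply: (@coef_injM3 L x y z) => a b d ax bY dz; apply: (bij_inj fb).
  have ab := gcompM _ ax bY; have bd := gcompM _ bY dz; have abd := gcompM _ ab dz.
  rewrite !(cL _ _ _ abd) !coefM -[LHS]mulrA -[RHS]mulrA.
  rewrite [RHS]mulrA -coefM [in RHS]UZ_mulC coefM -[RHS]mulrA.
  rewrite -(hc _ _ _ _ ab dz) [RHS]mulrA -(hc _ _ _ _ ax bY) -[a * b * d]mulrA.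
  rewrite -(hc _ _ _ _ ax bd) mulrA -coef_comm ?fg//.
  by rewrite -!mulrA -(hc _ _ _ _ bY dz).
pose cc : cochain Gh R 2 := fun t => c (tnth t ord0) (tnth t ord_max).
have ccE x y : cc [tuple x; y] = c x y by rewrite /cc !(tnth_nth 1%g).
have t2E (t : 2.-tuple Gh) : exists x y, t = [tuple x; y].
  by case: t => -[|x [|y [|? ?]]] // i; exists x, y; apply: val_inj.
have t3E (t : 3.-tuple Gh) : exists x y z, t = [tuple x; y; z].
  by case: t => -[|x [|y [|z [|? ?]]]] // i; exists x, y, z; apply: val_inj.
have ccZ : @rel_cocycle Gh G R phat 2 cc.
  apply/asboolP; split; first split=> t.
  - have [x [y ->]] := t2E t; rewrite ccE !inE.
    by case/orP => /eqP <-; [apply: c1l | apply: c1r].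
  - have [x [y ->]] := t2E t; rewrite ccE => ht.
    by apply: cG; apply: ht; rewrite !inE eqxx ?orbT.
  apply/funext => t; have [x [y [z ->]]] := t3E t.
  rewrite differential2E !ccE -mulgA UZ_mulACA cA.
  by rewrite UZ_mulACA !mulgV mulg1.
by exists (Sub cc ccZ), f.
Qed.

(** The quotient of two cocycles relating L to L' relates L to itself, so it is
    a coboundary; conversely, a map relating L to itself by a coboundary can be
    inserted before one relating L to L'. *)
Lemma twisted_class_unique c c' L L' :
  twisted c L L' -> twisted c' L L' <-> relH_class c = relH_class c'.
Proof.
move=> h; split=> [h'|/relH_classP e].
  apply/relH_classP.
  exact: twisted_coboundary (twisted_comp h (twisted_inv h')).
have {}e : rel_coboundary G phat (val (c' * c^-1)%g).
  by have := rel_coboundaryV e; rewrite invgF.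
rewrite -[c'](mulgVK c).
exact: twisted_comp (coboundary_twisted L e) h.
Qed.

End LiftTheory.

(** * Direct sums *)

Section DirectSum.
Variables (I : choiceType) (M : I -> zmodType).

Record dsum := Dsum {
  dsum_fun :> forall i, M i;
  dsum_fin : exists s : seq I, forall i, i \notin s -> dsum_fun i = 0 }.

HB.instance Definition _ := gen_eqMixin dsum.
HB.instance Definition _ := gen_choiceMixin dsum.

Lemma dsum_ext (f g : dsum) : (forall i, f i = g i) -> f = g.
Proof.
case: f g => [f hf] [g hg] /= efg; have e := functional_extensionality_dep efg.
by case: _ / e hg => hg; congr Dsum; apply: Prop_irrelevance.
Qed.

Fact dsum_zero_fin : exists s : seq I, forall i, i \notin s -> 0 = 0 :> M i.
Proof. by exists [::]. Qed.
Fact dsum_add_fin (f g : dsum) :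
  exists s : seq I, forall i, i \notin s -> f i + g i = 0.
Proof.
have [s hs] := dsum_fin f; have [t ht] := dsum_fin g.
exists (s ++ t) => i; rewrite mem_cat negb_or => /andP[si ti].
by rewrite hs ?ht ?addr0.
Qed.
Fact dsum_opp_fin (f : dsum) : exists s : seq I, forall i, i \notin s -> - f i = 0.
Proof. by have [s hs] := dsum_fin f; exists s => i /hs ->; rewrite oppr0. Qed.

Definition dsum_zero := Dsum dsum_zero_fin.
Definition dsum_add f g := Dsum (dsum_add_fin f g).
Definition dsum_opp f := Dsum (dsum_opp_fin f).

Fact dsum_addA : associative dsum_add.
Proof. by move=> f g h; apply: dsum_ext => i; apply: addrA. Qed.
Fact dsum_addC : commutative dsum_add.
Proof. by move=> f g; apply: dsum_ext => i; apply: addrC. Qed.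
Fact dsum_add0 : left_id dsum_zero dsum_add.
Proof. by move=> f; apply: dsum_ext => i; apply: add0r. Qed.
Fact dsum_addN : left_inverse dsum_zero dsum_opp dsum_add.
Proof. by move=> f; apply: dsum_ext => i; apply: addNr. Qed.
HB.instance Definition _ :=
  GRing.isZmodule.Build dsum dsum_addA dsum_addC dsum_add0 dsum_addN.

Lemma dsumDE (f g : dsum) i : (f + g) i = f i + g i.
Proof. by []. Qed.
Lemma dsumBE (f g : dsum) i : (f - g) i = f i - g i.
Proof. by []. Qed.
Lemma dsum_sumE (J : Type) (r : seq J) (F : J -> dsum) i :
  (\sum_(j <- r) F j) i = \sum_(j <- r) F j i.
Proof. exact: (big_morph (fun f : dsum => f i)). Qed.

Definition dinj_fun i (m : M i) j : M j :=
  if i =P j is ReflectT e then ecast k (M k) e m else 0.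

Fact dinj_fin i (m : M i) :
  exists s : seq I, forall j, j \notin s -> dinj_fun m j = 0.
Proof.
exists [:: i] => j; rewrite inE => ji; rewrite /dinj_fun.
by case: eqP => // e; rewrite e eqxx in ji.
Qed.
Definition dinj i (m : M i) : dsum := Dsum (dinj_fin m).

Lemma dinjE i (m : M i) : dinj m i = m.
Proof. by rewrite /= /dinj_fun; case: eqP => // e; rewrite eq_axiomK. Qed.
Lemma dinj_neq i (m : M i) j : j != i -> dinj m j = 0.
Proof. by move=> ji; rewrite /= /dinj_fun; case: eqP => // e; rewrite e eqxx in ji. Qed.

Lemma dinjP (f : dsum) i (m : M i) :
  f i = m -> (forall j, j != i -> f j = 0) -> f = dinj m.
Proof.
move=> fi fj; apply: dsum_ext => j.
by have [->|ji] := eqVneq j i; rewrite ?dinjE// dinj_neq// fj.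
Qed.

Lemma dinjD i : {morph @dinj i : m n / m + n}.
Proof.
move=> m n; apply/esym/dinjP => [|j ji]; rewrite dsumDE ?dinjE//.
by rewrite !dinj_neq ?addr0.
Qed.
Lemma dinj0 i : @dinj i 0 = 0.
Proof. by apply/esym/dinjP. Qed.

Definition dsupp (f : dsum) : seq I := undup (projT1 (cid (dsum_fin f))).

Lemma dsupp_uniq f : uniq (dsupp f).
Proof. exact: undup_uniq. Qed.
Lemma dsupp_out (f : dsum) i : i \notin dsupp f -> f i = 0.
Proof. by rewrite mem_undup; apply: (projT2 (cid (dsum_fin f))). Qed.

Section Extension.
Variables (V : zmodType) (F : forall i, M i -> V).
Hypothesis FD : forall i, {morph @F i : m n / m + n}.

Definition dext (f : dsum) : V := \sum_(i <- dsupp f) F (f i).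

Let F0 i : F (0 : M i) = 0.
Proof. by apply: (addIr (@F i 0)); rewrite -FD !add0r. Qed.

Lemma dext_sub (f : dsum) t : uniq t -> (forall i, i \notin t -> f i = 0) ->
  dext f = \sum_(i <- t) F (f i).
Proof.
move=> ut ft; pose w := undup (dsupp f ++ t).
rewrite /dext -(@sum_incl _ _ _ (dsupp f) w) ?dsupp_uniq ?undup_uniq//.
- rewrite (@sum_incl _ _ _ t w) ?undup_uniq//.
    by move=> i it; rewrite mem_undup mem_cat it orbT.
  by move=> i /ft ->.
- by move=> i it; rewrite mem_undup mem_cat it.
- by move=> i /dsupp_out ->.
Qed.

Lemma dextD : {morph dext : f g / f + g}.
Proof.
move=> f g; pose t := undup (dsupp f ++ dsupp g).
have ft i : i \notin t -> f i = 0.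
  by rewrite mem_undup mem_cat negb_or => /andP[/dsupp_out].
have gt i : i \notin t -> g i = 0.
  by rewrite mem_undup mem_cat negb_or => /andP[_ /dsupp_out].
rewrite !(@dext_sub _ t) ?undup_uniq//; last first.
  by move=> i it; rewrite dsumDE ft ?gt ?addr0.
by rewrite -big_split; apply: eq_bigr => i _; rewrite dsumDE FD.
Qed.

Lemma dext_inj i (m : M i) : dext (dinj m) = F m.
Proof.
rewrite (@dext_sub _ [:: i])// ?big_seq1 ?dinjE// => j.
by rewrite inE; apply: dinj_neq.
Qed.
End Extension.

Lemma dsum_decomp (f : dsum) : f = \sum_(i <- dsupp f) dinj (f i).
Proof.
apply: dsum_ext => i; rewrite dsum_sumE.
have [is'|is'] := boolP (i \in dsupp f); last first.
  rewrite dsupp_out// big_seq big1// => j js; apply: dinj_neq.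
  by apply: contraNneq is' => ->.
rewrite (bigD1_seq i) ?dsupp_uniq// dinjE big1 => [|j ji].
  exact/esym/addr0.
by rewrite dinj_neq// eq_sym.
Qed.

Lemma dsum_ind (P : dsum -> Prop) : P 0 ->
  (forall f g, P f -> P g -> P (f + g)) -> (forall i (m : M i), P (dinj m)) ->
  forall f, P f.
Proof. by move=> P0 PD Pi f; rewrite (dsum_decomp f); apply: big_ind. Qed.

Definition dcomp (i : I) : {pred dsum} :=
  fun f => `[< forall j, j != i -> f j = 0 >].

Fact dcomp_zmod i : zmod_closed (dcomp i).
Proof.
split=> [|f g /asboolP hf /asboolP hg]; apply/asboolP => // j ji.
by rewrite dsumBE hf// hg// subr0.
Qed.
HB.instance Definition _ i := GRing.isZmodClosed.Build dsum (dcomp i) (dcomp_zmod i).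

Lemma dcompP i (f : dsum) : f \in dcomp i -> f = dinj (f i).
Proof. by move=> /asboolP hf; apply: dinjP. Qed.
Lemma dinj_comp i (m : M i) : dinj m \in dcomp i.
Proof. by apply/asboolP => j; apply: dinj_neq. Qed.

Lemma dcomp_direct (s : seq I) (f : I -> dsum) : uniq s ->
  (forall i, f i \in dcomp i) -> \sum_(i <- s) f i = 0 ->
  forall i, i \in s -> f i = 0.
Proof.
move=> us hf e i si; rewrite (dcompP (hf i)).
move: (congr1 (fun g : dsum => g i) e); rewrite dsum_sumE (bigD1_seq i)//.
rewrite big1 => [/= /(etrans (esym (addr0 _))) ->|j ji]; first exact: dinj0.
by rewrite (dcompP (hf j)) dinj_neq// eq_sym.
Qed.
End DirectSum.

(** * The generalized crossed product *)

Section CrossedProduct.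
Variables (Gh : groupType) (G : groupClosed Gh) (S : gradedRing G).
Local Notation R := (principal S).
Variables (phat : Gh -> pic R) (M : charData phat) (b : cochain Gh R 2).
Hypothesis b_rel : rel_cochain G b.
Hypothesis db : alpha_cochain M = differential phat b.

Let b1l x : b [tuple 1%g; x] = 1%g.
Proof. by have [h _] := b_rel; apply: h; rewrite !inE eqxx. Qed.
Let b1r x : b [tuple x; 1%g] = 1%g.
Proof. by have [h _] := b_rel; apply: h; rewrite !inE eqxx orbT. Qed.
Let bG g h : g \in G -> h \in G -> b [tuple g; h] = 1%g.
Proof.
have [_ r] := b_rel => hg hh; apply: r => k.
by rewrite !inE => /orP[]/eqP->.
Qed.

Definition bmul x y (m : M x) (n : M y) : M (x * y)%g :=
  val (b [tuple x; y]) *: cd_mu (m \ox n).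

Lemma bmulDl x y (n : M y) : {morph (@bmul x y)^~ n : m m' / m + m'}.
Proof.
by move=> m m'; rewrite /bmul tpureDl; have [[-> _ _] _] := cd_mu_isom M x y;
   rewrite scalerDr.
Qed.
Lemma bmulDr x y (m : M x) : {morph @bmul x y m : n n' / n + n'}.
Proof.
by move=> n n'; rewrite /bmul tpureDr; have [[-> _ _] _] := cd_mu_isom M x y;
   rewrite scalerDr.
Qed.

(** With alpha the coboundary of b, the factors b(xy,z) b(x,y) alpha(x,y,z) and
    b(x,yz) (x.b(y,z)) on the two sides of the associativity equation
    agree. *)
Lemma bmulA x y z (m : M x) (n : M y) (p : M z) :
  bmul (bmul m n) p = bcast M (mulgA x y z) (bmul m (bmul n p)).
Proof.
have E : (alpha M x y z * b [tuple x; y] * b [tuple (x * y)%g; z] =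
    b [tuple x; (y * z)%g] * pic_act (phat x) (b [tuple y; z]))%g.
  by rewrite -alpha_cochainE db differential2E mulgVK UZ_mulVCK.
have cE u v (m' : M u) (n' : M v) : cd_mu (m' \ox n') = cdot erefl m' n' by [].
rewrite /bmul !cE cdotZl cdotZr !scalerA bcastZ.
rewrite -[bcast M _ (cdot _ _ _)]/(cdot (mulgA x y z) m (cdot erefl n p)).
rewrite (cdotA erefl erefl erefl (mulgA x y z)) scalerA -!UZ_valM -E.
by congr (val _ *: _); rewrite UZ_mulC (UZ_mulC (b [tuple (x * y)%g; z])) mulgA.
Qed.

Definition cross := @dsum Gh (fun x => M x).
HB.instance Definition _ := GRing.Zmodule.on cross.

Lemma dinj_cast x y (e : x = y) (m : M x) : dinj (bcast M e m) = dinj m :> cross.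
Proof. by case: _ / e. Qed.

Definition cross_mul (f g : cross) : cross :=
  dext (fun x m => dext (fun y n => dinj (bmul m n)) g) f.

Let dinj_bmulDr x (m : M x) y :
  {morph (fun n : M y => dinj (bmul m n) : cross) : n n' / n + n'}.
Proof. by move=> n n'; rewrite /= bmulDr dinjD. Qed.

Let dext_bmulDl (g : cross) x :
  {morph (fun m : M x => dext (fun y n => dinj (bmul m n)) g : cross) : m m' / m + m'}.
Proof.
move=> m m'; rewrite /dext -big_split; apply: eq_bigr => y _.
by rewrite bmulDl dinjD.
Qed.

Lemma cross_mulDl : left_distributive cross_mul +%R.
Proof. by move=> f g h; apply: dextD => x; apply: dext_bmulDl. Qed.
Lemma cross_mulDr : right_distributive cross_mul +%R.
Proof.
move=> f g h; rewrite /cross_mul {1 3 4}/dext -big_split; apply: eq_bigr => x _.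
by rewrite dextD// => y; apply: dinj_bmulDr.
Qed.
Lemma cross_mul_inj x y (m : M x) (n : M y) :
  cross_mul (dinj m) (dinj n) = dinj (bmul m n).
Proof.
rewrite /cross_mul dext_inj; last by move=> z; apply: dext_bmulDl.
by rewrite dext_inj// => z; apply: dinj_bmulDr.
Qed.
Lemma cross_mul0r f : cross_mul 0 f = 0.
Proof. by apply: (addIr (cross_mul 0 f)); rewrite -cross_mulDl !add0r. Qed.
Lemma cross_mulr0 f : cross_mul f 0 = 0.
Proof. by apply: (addIr (cross_mul f 0)); rewrite -cross_mulDr !add0r. Qed.

Fact cross_mulA : associative cross_mul.
Proof.
move=> f g h; elim/dsum_ind: f => [|f f' e e'|x m].
- by rewrite !cross_mul0r.
- by rewrite !cross_mulDl e e'.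
elim/dsum_ind: g => [|g g' e e'|y n].
- by rewrite !(cross_mul0r, cross_mulr0).
- by rewrite !(cross_mulDl, cross_mulDr) e e'.
elim/dsum_ind: h => [|h h' e e'|z p].
- by rewrite !cross_mulr0.
- by rewrite !cross_mulDr e e'.
by rewrite !cross_mul_inj bmulA dinj_cast.
Qed.

Definition cross_base (r : R) : cross := dinj (@cd_id _ _ _ _ M 1%g r).

Lemma cross_basel r x (m : M x) : cross_mul (cross_base r) (dinj m) = dinj (r *: m).
Proof.
by rewrite cross_mul_inj /bmul b1l UZ_val1 scale1r cd_mu1l dinj_cast.
Qed.
Lemma cross_baser r x (m : M x) : cross_mul (dinj m) (cross_base r) = dinj (m <*: r).
Proof.
by rewrite cross_mul_inj /bmul b1r UZ_val1 scale1r cd_mu1r dinj_cast.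
Qed.
Fact cross_mul1 : left_id (cross_base 1) cross_mul.
Proof.
elim/dsum_ind => [|f g e e'|x m]; first exact: cross_mulr0.
  by rewrite cross_mulDr e e'.
by rewrite cross_basel scale1r.
Qed.
Fact cross_mulr1 : right_id (cross_base 1) cross_mul.
Proof.
elim/dsum_ind => [|f g e e'|x m]; first exact: cross_mul0r.
  by rewrite cross_mulDl e e'.
by rewrite cross_baser ract1.
Qed.
HB.instance Definition _ := GRing.Zmodule_isPzRing.Build cross
  cross_mulA cross_mul1 cross_mulr1 cross_mulDl cross_mulDr.

Definition cross_comp (x : Gh) : zmodClosed cross := @dcomp _ _ x.

Fact cross_compM x y (f g : cross) :
  f \in cross_comp x -> g \in cross_comp y -> f * g \in cross_comp (x * y)%g.
Proof.
move=> /dcompP -> /dcompP ->; rewrite [X in X \in _]cross_mul_inj.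
exact: dinj_comp.
Qed.
Fact cross_sum (f : cross) : exists (s : seq Gh) (h : Gh -> cross),
  [/\ uniq s, forall x, h x \in cross_comp x & f = \sum_(x <- s) h x].
Proof.
exists (dsupp f), (fun x => dinj (f x)); split; first exact: dsupp_uniq.
  by move=> x; apply: dinj_comp.
exact: dsum_decomp.
Qed.
Fact cross_out x (f : cross) : x \notin @wholeGroup Gh -> f \in cross_comp x -> f = 0.
Proof. by []. Qed.

Definition cross_gr : gradedRing (@wholeGroup Gh) :=
  @GradedRing Gh (@wholeGroup Gh) cross cross_comp cross_out cross_compM
    cross_sum (@dcomp_direct _ _).

(** Strong grading is the surjectivity of b(x,y) mu_(x,y). *)
Fact cross_strong : strongly_graded cross_gr.
Proof.
move=> x y _ _ f /dcompP ->; set m := dsum_fun f _.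
have [Phi [hPhi _ PhiK]] := bimod_isom_inv (cd_mu_isom M x y).
pose t := Phi (val (b [tuple x; y])^-1%g *: m).
exists [seq (dinj p.1 : cross, dinj p.2 : cross) | p <- repr t]; split.
  by move=> p /mapP[q _ ->]; split; apply: dinj_comp.
rewrite big_map; transitivity (\sum_(p <- repr t) dinj (bmul p.1 p.2) : cross); last first.
  by apply: eq_bigr => p _; rewrite [RHS]cross_mul_inj.
rewrite -(big_morph _ (@dinjD _ _ (x * y)%g) (@dinj0 _ _ (x * y)%g)); congr dinj.
rewrite /bmul -scaler_sumr -(bimod_hom_sum _ _ (cd_mu_isom M x y).1).
rewrite -[X in cd_mu X](tens_sum t) /t PhiK scalerA -UZ_valM mulgV.
by rewrite UZ_val1 scale1r.
Qed.

(** Outside G the maps cd_id are arbitrary and may not even send 0 to 0, so these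
    degrees are treated apart although S vanishes there. *)
Definition cross_in_fun (s : S) x : M x :=
  if x \in G then @cd_id _ _ _ _ M _ (Sub (proj s x) (proj_in s x) : component S x) else 0.

Lemma cd_idD g : g \in G -> {morph @cd_id _ _ _ _ M g : s t / s + t}.
Proof. by move=> hg; have [[]] := cd_id_isom M hg. Qed.
Lemma cd_id0 g : g \in G -> @cd_id _ _ _ _ M g 0 = 0.
Proof. by move=> hg; have [h _] := cd_id_isom M hg; apply: bimod_hom0. Qed.

Fact cross_in_fin s : exists t : seq Gh, forall x, x \notin t -> cross_in_fun s x = 0.
Proof.
exists (supp s) => x xs; rewrite /cross_in_fun; case: ifP => // xG.
by rewrite -(cd_id0 xG); congr cd_id; apply: val_inj; rewrite /= proj_out.
Qed.
Definition cross_in (s : S) : cross_gr := Dsum (cross_in_fin s).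

Lemma cross_inD : {morph cross_in : s t / s + t}.
Proof.
move=> s t; apply: dsum_ext => x; rewrite dsumDE /= /cross_in_fun.
case: ifP => xG; last by rewrite addr0.
by rewrite -cd_idD//; congr cd_id; apply: val_inj; rewrite /= projD.
Qed.
Lemma cross_in_homog g (s : component S g) : g \in G ->
  cross_in (val s) = dinj (@cd_id _ _ _ _ M _ s).
Proof.
move=> gG; apply: dinjP => [|x xg]; rewrite /= /cross_in_fun.
  by rewrite gG; congr cd_id; apply: val_inj; rewrite /= (proj_homog _ (valP s)) eqxx.
case: ifP => // xG; rewrite -(cd_id0 xG); congr cd_id; apply: val_inj.
by rewrite /= (proj_homog _ (valP s)) (negbTE xg).
Qed.
Lemma cross_in0 : cross_in 0 = 0.
Proof. by apply: (addIr (cross_in 0)); rewrite -cross_inD !add0r. Qed.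

Fact cross_in_zmod : GRing.zmod_morphism cross_in.
Proof.
by move=> s t; apply/eqP; rewrite eq_sym subr_eq -cross_inD subrK.
Qed.
Fact cross_in_monoid : GRing.monoid_morphism cross_in.
Proof.
split; first exact: (cross_in_homog (1 : R) (gpred1 (s := G))).
move=> s t; elim/homog_ind: s => [|s s' h h'|g s sg].
- by rewrite mul0r cross_in0 mul0r.
- by rewrite mulrDl !cross_inD mulrDl h h'.
elim/homog_ind: t => [|t t' h h'|k t tk].
- by rewrite mulr0 cross_in0 mulr0.
- by rewrite mulrDr !cross_inD mulrDr h h'.
have [hg|hg] := boolP (g \in G); last first.
  by rewrite (gcomp_out hg sg) mul0r cross_in0 mul0r.
have [hk|hk] := boolP (k \in G); last first.
  by rewrite (gcomp_out hk tk) mulr0 cross_in0 mulr0.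
pose s' : component S g := Sub s sg; pose t' : component S k := Sub t tk.
rewrite -[s * t]/(val (gmul s' t' : component S (g * k)%g)).
rewrite -[s in RHS]/(val s') -[t in RHS]/(val t') !cross_in_homog ?gpredM//.
by rewrite [RHS]cross_mul_inj /bmul bG// UZ_val1 scale1r cd_mu_mul.
Qed.
HB.instance Definition _ := GRing.isZmodMorphism.Build S cross_gr cross_in cross_in_zmod.
HB.instance Definition _ := GRing.isMonoidMorphism.Build S cross_gr cross_in cross_in_monoid.

Fact cross_in_inj : injective cross_in.
Proof.
move=> s t e; suff: s - t = 0 by move/eqP; rewrite subr_eq0 => /eqP.
have {e}: cross_in (s - t) = 0 by rewrite cross_in_zmod e subrr.
move: (s - t) => {s t}s e; rewrite (proj_sum s) big1// => x _.
have [xG|xG] := boolP (x \in G); last exact: gcomp_out xG (proj_in s x).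
have := congr1 (fun f : cross => f x) e; rewrite /= /cross_in_fun xG -(cd_id0 xG).
by have [_ /bij_inj inj] := cd_id_isom M xG; move=> /inj/(congr1 val).
Qed.

Fact cross_in_comp g : g \in G -> forall a, a \in gcomp cross_gr g <->
  exists2 s, s \in gcomp S g & cross_in s = a.
Proof.
move=> gG a; split=> [/dcompP ->|[s sg <-]].
  have [s ->] := cd_id_surj gG (dsum_fun a g).
  by exists (val s); [apply: (valP s) | apply: cross_in_homog].
by rewrite -[s]/(val (Sub s sg : component S g)) cross_in_homog//; apply: dinj_comp.
Qed.

Definition cross_lift : Defs.lift S :=
  @Lift Gh G S cross_gr cross_strong cross_in cross_in_inj cross_in_comp.

Fact cross_picard : has_picard cross_lift phat.
Proof.
move=> x; apply/(pic_iso _ (cd_pic M x)).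
exists (fun m : M x => Sub (dinj m) (dinj_comp m) : lift_component cross_lift x).
have bE r : lift_base cross_lift r = cross_base r.
  exact: (cross_in_homog r (gpred1 (s := G))).
split; first split=> [m n|r m|m r]; try apply: val_inj.
- by rewrite /= dinjD.
- by rewrite [RHS](_ : _ = lift_base cross_lift r * (dinj m : cross))// bE [RHS]cross_basel.
- by rewrite [RHS](_ : _ = (dinj m : cross) * lift_base cross_lift r)// bE [RHS]cross_baser.
exists (fun f : lift_component cross_lift x => (val f : cross) x) => [m|f].
  exact: dinjE.
by apply: val_inj; rewrite /= -dcompP//; apply: (valP f).
Qed.

Definition cross_picLift : picLift phat := PicLift cross_picard.
End CrossedProduct.

(** * The action *)

(** The vanishing of kappa provides the cochain b with coboundary alpha. *)
Lemma picLift_inhabited (Gh : groupType) (G : groupClosed Gh) (S : gradedRing G)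
    (phat : Gh -> pic (principal S)) (M : charData phat) :
  kappa M = 1%g -> exists L : picLift phat, True.
Proof.
move=> /relH_classP /= [b b_rel e]; suff db : alpha_cochain M = differential phat b.
  by exists (cross_picLift b_rel db).
by rewrite -e invg1 mulg1.
Qed.

Theorem theorem3p6 (Gh : groupType) (G : groupClosed Gh)
    (S : gradedRing G) (S_strong : strongly_graded S)
    (phat : Gh -> pic (principal S))
    (phat_hom : forall x y : Gh, phat (x * y)%g = pic_mul (phat x) (phat y))
    (phat_ext : forall g : Gh, g \in G -> phat g (component S g))
    (M : charData phat) (kappa_trivial : kappa M = 1%g) :
  exists act : relH G phat 2 -> liftClass phat -> liftClass phat,
    [/\ forall (c : relZ G phat 2) (L : picLift phat),
          act (relH_class c) (lift_class L) = lift_class (twist L c),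
        is_left_action act
      & simply_transitive act].
Proof.
pose rep (l : liftClass phat) := projT1 (cid (lift_class_surj l)).
have repK l : lift_class (rep l) = l by rewrite /rep; case: cid.
exists (fun k l => lift_class (twist (rep l) (repr k))).
set act := fun k l => _.
(* The action is defined through representatives L0 and c0 of the two classes;
   this characterization does not refer to them. *)
have actP c L L' : act (relH_class c) (lift_class L) = lift_class L' <-> twisted c L L'.
  have h0 : twisted 1%g L (rep (lift_class L)).
    by apply/twisted_one/lift_classP; rewrite repK.
  set L0 := rep _ in h0; set c0 := repr (relH_class c).
  have h1 : twisted c0 L (twist L0 c0).
    by have := twisted_comp h0 (twisted_twist c0 L0); rewrite mul1g.
  have h2 : twisted c L (twist L0 c0).
    by apply/(twisted_class_unique _ h1); rewrite relH_reprK.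
  rewrite /act -/L0 -/c0 lift_classP twisted_one; split=> h.
    by have := twisted_comp h2 h; rewrite mulg1.
  by have := twisted_comp (twisted_inv h2) h; rewrite mulVg.
split=> [c L||].
- by apply/actP/twisted_twist.
- split=> [l|k k' l].
    by rewrite -(repK l); apply/actP/twisted_one/lift_equiv_refl.
  rewrite -(repK l) -(relH_reprK k) -(relH_reprK k') -relH_classM.
  set L := rep l; have -> : act (relH_class (repr k')) (lift_class L) =
    lift_class (twist L (repr k')) by apply/actP/twisted_twist.
  have -> : act (relH_class (repr k)) (lift_class (twist L (repr k'))) =
    lift_class (twist (twist L (repr k')) (repr k)) by apply/actP/twisted_twist.
  apply/actP.
  (* Composing the relations multiplies the cocycles in the opposite order. *)
  have -> : (repr k * repr k' = repr k' * repr k)%g.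
    by apply: val_inj; apply: cochain_mulC.
  exact: twisted_comp (twisted_twist _ _) (twisted_twist _ _).
split; first by have [L _] := picLift_inhabited kappa_trivial; exists; apply: lift_class L.
move=> l l'; rewrite -(repK l) -(repK l').
have [c hc] := picLift_twisted (rep l) (rep l').
exists (relH_class c); split=> [|k]; first exact/actP.
by rewrite -(relH_reprK k) => /actP/(twisted_class_unique _ hc).
Qed.
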